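(* Let $(\xi,J)$ be a Markov additive process with $\xi$ nondecreasing, with Bernstein matrix $\mathbf\Phi$, whose Markov chain of types is irreducible and whose position component is not a.s. constant. Assume that $k^{(i)}>0$ for at least one $i\in[K]$, and let $T=\inf\{t\ge0:\xi_t=\infty\}$ be the death time of $\xi$. For $p\in\mathbb R$ let $f_i(p)=\mathbb E_i[e^{-p\xi_{T^-}}]$, and let $\mathbf F(p)=(f_i(p))_{i\in[K]}$ and $\mathbf K=(k^{(i)})_{i\in[K]}$ be column vectors. Then for every $p>\underline p$ such that $-\lambda(-\mathbf\Phi(p))>0$, $$\mathbf F(p)=(\mathbf\Phi(p))^{-1}\mathbf K.$$
   Context: Fix $K\in\mathbb N$, $[K]=\{1,\dots,K\}$. A Markov additive process (MAP) is a Markov process $((\xi_t,J_t),t\ge0)$ on $\mathbb R\times[K]\cup\{(+\infty,0)\}$, with law $\mathbb P_{(x,i)}$ when started at $(x,i)$, such that for all $t$ and $(x,i)$, under $\mathbb P_{(x,i)}$, conditionally on $(\xi_u,J_u)_{u\le t}$ and $\xi_t<\infty$, the process $((\xi_{t+s}-\xi_t,J_{t+s}),s\ge0)$ has law $\mathbb P_{(0,J_t)}$, and $(+\infty,0)$ is absorbing. $\mathbb P_i=\mathbb P_{(0,i)}$, with expectation $\mathbb E_i$. A MAP with $\xi$ nondecreasing is characterised by: the transition rate matrix $\mathbf\Lambda=(\lambda_{i,j})$ of the chain $J$ (before killing); probability distributions $B_{i,j}$ on $[0,\infty)$ (law of the jump of $\xi$ when $J$ jumps from $i$ to $j$, $B_{i,i}=\delta_0$),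 with $\widehat B_{i,j}(p)=\int_0^\infty e^{-px}B_{i,j}(dx)$; and triplets $(k^{(i)},c^{(i)},\Pi^{(i)})$ (killing rate, drift, L\'evy measure with $\int_{(0,\infty)}(1\wedge x)\Pi^{(i)}(dx)<\infty$) of the subordinator followed by $\xi$ while $J=i$, with Laplace exponent $\psi_i(p)=k^{(i)}+c^{(i)}p+\int_0^\infty(1-e^{-px})\Pi^{(i)}(dx)$. The Bernstein matrix is $\mathbf\Phi(p)=\mathrm{diag}(\psi_i(p))_{i\in[K]}-\big(\lambda_{i,j}\widehat B_{i,j}(p)\big)_{i,j\in[K]}$, defined (and analytic) for $p>\underline p$, where $$\underline p=\inf\Big\{p\in\mathbb R:\ \int_0^\infty(e^{-px}-1)\Pi^{(i)}(dx)<\infty\ \text{for all } i,\ \lambda_{i,j}\int_0^\infty e^{-px}B_{i,j}(dx)<\infty\ \text{for all } i,j\Big\}.$$ For a square matrix $\mathbf A$ with nonnegative off-diagonal entries, $\lambda(\mathbf A)$ is the maximal real part of the eigenvalues of $\mathbf A$. *)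

(* Defs.v *)
From HB Require Import structures.
From mathcomp Require Import all_boot all_order all_algebra.
From mathcomp Require Import complex.
From mathcomp Require Import all_classical all_reals all_analysis.
Set Implicit Arguments.
Unset Strict Implicit.
Unset Printing Implicit Defensive.
Import Order.TTheory GRing.Theory Num.Theory.
Import numFieldNormedType.Exports.
Local Open Scope classical_set_scope.
Local Open Scope ring_scope.

(* Maximal real part of the (complex) eigenvalues of a real square matrix.
   The set below is finite, and nonempty when n > 0, so its supremum is a
   maximum. *)
Definition spectral_abscissa (R : realType) (n : nat) (A : 'M[R]_n) : R :=
  sup [set complex.Re z | z in
        [set z : R[i] | eigenvalue (map_mx (real_complex R) A) z]].

(* Measures on [0, oo) and (0, oo) are encoded as measures on R, and all the
   integrals are restricted to the relevant half line. *)
Record characteristics (R : realType) (K : nat) := Characteristics {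
  rate : 'M[R]_K ;
  jump : 'I_K -> 'I_K -> probability (measurableTypeR R) R ;
  kill : 'I_K -> R ;
  drift : 'I_K -> R ;
  levy : 'I_K -> {measure set (measurableTypeR R) -> \bar R} ;
  rate_ge0 : forall i j, i != j -> 0 <= rate i j ;
  rate_sum0 : forall i, \sum_j rate i j = 0 ;
  jump_ge0 : forall i j, jump i j `[0, +oo[%classic = 1%E ;
  jump_diag : forall i A, measurable A -> jump i i A = \d_(0 : R) A ;
  kill_ge0 : forall i, 0 <= kill i ;
  drift_ge0 : forall i, 0 <= drift i ;
  levy_fin : forall i,
    (\int[levy i]_(x in `]0%R, +oo[) (Num.min 1 x)%:E < +oo)%E }.

Section bernstein.
Context (R : realType) (K : nat) (ch : characteristics R K).

Definition irreducible_rates : Prop :=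
  forall i j, connect (fun a b : 'I_K => 0 < rate ch a b) i j.

Definition laplace_exponent (i : 'I_K) (p : R) : R :=
  kill ch i + drift ch i * p +
  \int[levy ch i]_(x in `]0, +oo[) (1 - expR (- (p * x))).

Definition jump_laplace (i j : 'I_K) (p : R) : R :=
  \int[jump ch i j]_(x in `[0, +oo[) expR (- (p * x)).

Definition Bernstein_matrix (p : R) : 'M[R]_K :=
  diag_mx (\row_i laplace_exponent i p) -
  \matrix_(i, j) (rate ch i j * jump_laplace i j p).

Definition p_lower : \bar R :=
  ereal_inf [set p%:E | p in [set p : R |
    (forall i, (\int[levy ch i]_(x in `]0%R, +oo[)
                  (expR (- (p * x)) - 1)%:E < +oo)%E) /\
    (forall i j, ((rate ch i j)%:E * \int[jump ch i j]_(x in `[0%R, +oo[)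
                  (expR (- (p * x)))%:E < +oo)%E)]].

End bernstein.

(* The state space R x [K] with the cemetery (+oo, 0) encoded as None. Times
   are the nonnegative elements of R: the values of a path at negative times
   are never constrained nor used. *)
Definition traj (R : realType) (K : nat) := R -> option (R * 'I_K).

Section paths.
Context (R : realType) (K : nat).
Implicit Types (w : traj R K) (t s : R).

Definition pos w t : \bar R := if w t is Some (x, _) then x%:E else +oo%E.

Definition chain w t : option 'I_K := omap snd (w t).

Definition pos_left w t : \bar R := lim (pos w s @[s --> t^'-]).

Definition shift t w : traj R K := fun s =>
  if (w t, w (t + s)) is (Some (x, _), Some (y, j)) then Some (y - x, j)
  else None.

(* Regularity of the paths of the process, started in
   R x [K]: right-continuity (for the discrete topology on types). The left
   limits of the position exist by monotonicity. *)
Record regular_path w : Prop := RegularPath {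
  path_start : w 0 <> None ;
  path_absorb : forall s t, 0 <= s -> s <= t -> w s = None -> w t = None ;
  path_nondecreasing : forall s t, 0 <= s -> s <= t -> (pos w s <= pos w t)%E ;
  path_pos_rcont : forall t, 0 <= t -> pos w s @[s --> t^'+] --> pos w t ;
  path_type_rcont : forall t, 0 <= t ->
    \forall s \near t^'+, chain w s = chain w t }.

(* The sigma-algebra on paths generated by the coordinates with index in I. *)
Definition cylinder_events (I : set R) : set (set (traj R K)) :=
  <<s [set E | exists t j (A : set (measurableTypeR R)),
        [/\ I t, measurable A &
            E = [set w : traj R K | exists2 x, w t = Some (x, j) & A x]]] >>.

Definition death_time w : \bar R :=
  ereal_inf [set t%:E | t in [set t : R | 0 <= t /\ pos w t = +oo%E]].

(* xi_{T-}; when the path never dies, the limit at +oo. *)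
Definition pos_before_death w : \bar R :=
  if death_time w is r%:E then pos_left w r
  else lim (pos w s @[s --> +oo]).

(* First time at which the type changes, by a jump of J or by killing. *)
Definition switch_time w : \bar R :=
  ereal_inf [set t%:E | t in [set t : R | 0 <= t /\ chain w t <> chain w 0]].

End paths.

Section MAP.
Context (R : realType) (K : nat) (d : measure_display) (Om : measurableType d).
Variables (X : Om -> traj R K) (P : R -> 'I_K -> probability Om R).

(* P x i is the law of the process started at (x, i). The field MAP_markov
   says that under P x i, conditionally on the events G of the past up to t
   and on X t being alive with type j, the shifted process has the law of the
   process under P 0 j. *)
Record nondecreasing_MAP : Prop := NondecreasingMAP {
  MAP_path : forall o, regular_path (X o) ;
  MAP_measurable : forall t j (A : set (measurableTypeR R)),
    0 <= t -> measurable A ->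
    measurable [set o | exists2 x, X o t = Some (x, j) & A x] ;
  MAP_start : forall x i, P x i [set o | X o 0 = Some (x, i)] = 1%E ;
  MAP_markov : forall x i t j (G D : set (traj R K)), 0 <= t ->
    cylinder_events `[0, t]%classic G -> cylinder_events `[0, +oo[%classic D ->
    P x i [set o | [/\ G (X o), chain (X o) t = Some j & D (shift t (X o))]] =
    (P x i [set o | G (X o) /\ chain (X o) t = Some j] *
     P 0%R j [set o | D (X o)])%E }.

Definition position_as_constant : Prop :=
  forall i, {ae P 0 i, forall o, forall t, 0 <= t ->
    X o t <> None -> pos (X o) t = pos (X o) 0}.

(* mu t is the (defective) law at time t, on the event of being alive, of a
   killed subordinator with Laplace exponent psi started at 0. *)
Definition subordinator_laws (psi : R -> R)
    (mu : R.-spker (measurableTypeR R) ~> (measurableTypeR R)) : Prop :=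
  forall t : R, 0 <= t -> mu t `]-oo, 0[%classic = 0%E /\
    forall q : R, 0 <= q ->
      (\int[mu t]_(x in `[0%R, +oo[) (expR (- (q * x)))%:E =
       (expR (- (t * psi q)))%:E)%E.

(* With sigma the first switching time, under P 0 i the position follows a
   killed subordinator with Laplace exponent psi_i (killed at rate k^(i)) up to
   an independent exponential clock of parameter - lambda_{i,i} =
   \sum_(j != i) lambda_{i,j}. MAP_stay is the law before sigma, MAP_switch the
   joint law of (sigma, xi_{sigma-}, J_sigma, xi_sigma - xi_{sigma-}) when J
   jumps at sigma (J_sigma = j at rate lambda_{i,j}, with an independent jump of
   xi of law B_{i,j}), and MAP_kill that of (sigma, xi_{sigma-}) when the
   process is killed at sigma. Together with the Markov property this determines
   the evolution of (xi, J). *)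
Record has_characteristics_from (ch : characteristics R K) (i : 'I_K)
    (mu : R.-spker (measurableTypeR R) ~> (measurableTypeR R)) : Prop :=
  HasCharacteristicsFrom {
  MAP_subordinator : subordinator_laws (laplace_exponent ch i) mu ;
  MAP_stay : forall t (A : set (measurableTypeR R)), 0 <= t -> measurable A ->
    P 0 i [set o | (t%:E < switch_time (X o))%E /\
                   exists2 x, X o t = Some (x, i) & A x] =
    ((expR (rate ch i i * t))%:E * mu t A)%E ;
  MAP_switch : forall t j (A C : set (measurableTypeR R)), 0 <= t -> j != i ->
    measurable A -> measurable C ->
    P 0 i [set o | exists s x y,
             [/\ s <= t, switch_time (X o) = s%:E, X o s = Some (y, j),
                 pos_left (X o) s = x%:E & A x /\ C (y - x)]] =
    (\int[lebesgue_measure]_(s in `[0%R, t])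
       ((rate ch i j * expR (rate ch i i * s))%:E * mu s A) *
     jump ch i j C)%E ;
  MAP_kill : forall t (A : set (measurableTypeR R)), 0 <= t -> measurable A ->
    P 0 i [set o | exists s x,
             [/\ s <= t, switch_time (X o) = s%:E, X o s = None,
                 pos_left (X o) s = x%:E & A x]] =
    (\int[lebesgue_measure]_(s in `[0%R, t])
       ((kill ch i * expR (rate ch i i * s))%:E * mu s A))%E }.

Definition has_characteristics (ch : characteristics R K) : Prop :=
  forall i, exists mu, has_characteristics_from ch i mu.

(* f_i(p) = E_i[exp(- p xi_{T-})], a priori in [0, +oo]. *)
Definition death_laplace (i : 'I_K) (p : R) : \bar R :=
  (\int[P 0%R i]_o expeR (- (p%:E * pos_before_death (X o))))%E.

End MAP.

(* Main.v *)
(* Decompose at the first time sigma at which the type changes, by a jump of J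
   or by killing. If sigma is a killing time, xi_{T-} = xi_{sigma-}; otherwise the
   Markov property restarts the process from (xi_sigma, J_sigma). With
   r_i = psi_i(p) - lambda_{i,i}, the laws of (sigma, xi_{sigma-}, J_sigma,
   xi_sigma - xi_{sigma-}) give
     r_i f_i = k^(i) + sum_{j <> i} lambda_{i,j} B^_{i,j}(p) f_j,
   that is Phi(p) F(p) = K.

   For p < 0 three points need care. First, E[exp(-p xi_t)] = exp(-t psi_i(p)) is
   only given for p >= 0: both sides are power series with nonnegative coefficients
   in u = 1 - p, which agree on [0, 1], hence wherever one of them converges.
   Second, only the Markov property at fixed times is given: it is applied at the
   first time of the grid (1 / (n + 1)) N at which the type has changed, and n goes
   to infinity. Third, F(p) is not known to be finite: the truncations
   E_i[min(exp(-p xi_{T-}), N)] satisfy Phi(p) F_N <= K because the truncated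
   exponential is submultiplicative, and Phi(p) is an M-matrix (its resolvent
   applied to the constant vector 1 remains positive from s = +oo down to s = 0,
   as no real s >= 0 is an eigenvalue of - Phi(p)), so F_N <= Phi(p)^-1 K. *)
From HB Require Import structures.
Require Import Defs.
From mathcomp Require Import all_boot all_order all_algebra.
From mathcomp Require Import complex.
From mathcomp Require Import all_classical all_reals all_analysis.
From mathcomp Require Import measurable_realfun measurable_fun_approximation simple_functions.
From mathcomp Require Import ring lra.
Set Implicit Arguments.
Unset Strict Implicit.
Unset Printing Implicit Defensive.
Import Order.TTheory GRing.Theory Num.Theory.
Import numFieldNormedType.Exports.
Local Open Scope classical_set_scope.
Local Open Scope ring_scope.

(** * M-matrices *)

(** The linear system does not identify F by itself: it is compatible with infinite entries, and
    linear algebra needs finite ones. Hence two inequalities, in which Fatou and dominated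
    convergence exchange roles. On the grid, [Z n] approximates g(xi_{T-}) and [Y n] approximates
    f(xi_sigma), both on the exit towards j. For F_N, [Y n] is bounded and Fatou is applied to
    [Z n]; once F is known to be finite, [Z n] is dominated by an integrable variable and Fatou is
    applied to [Y n]. With y = Phi(p)^-1 K, this gives Phi(p) (y - F_N) >= 0, then Phi(p) (F - y) >=
    0.

    The M-matrix property is used through a vector v > 0 with Phi(p) v > 0. The same vector yields
    r_i > 0, without which the time integrals at the first switch would diverge. That a switch
    almost surely occurs is the case p = 0 of the same integrals, where r_i = k^(i) - lambda_{i,i}
    is positive by irreducibility and killing.

    The power series are centred at p = 1 because the weight e^{-x} makes all moments finite there,
    while at p = 0 the moments of the law of xi_t are not known a priori to be finite. *)

Section spectral.
Variables (R : realType) (n : nat).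
Implicit Type M : 'M[R]_n.

(** [sup] dominates its set only when the set is bounded above; the sum of |Re r| over the roots of
    the characteristic polynomial is a crude bound. *)
Lemma eigenvalue_Re_bounded M :
  has_ubound [set complex.Re z | z in
    [set z : R[i] | eigenvalue (map_mx (real_complex R) M) z]].
Proof.
have [rs prs] := closed_field_poly_normal (char_poly (map_mx (real_complex R) M)).
exists (\sum_(r <- rs) `|complex.Re r|) => _ [z /= + <-].
rewrite eigenvalue_root_char prs (monicP (char_poly_monic _)) scale1r root_prod_XsubC.
move=> zrs; rewrite (big_rem _ zrs) /= (le_trans (ler_norm _))// lerDl.
by apply: sumr_ge0 => i _; exact: normr_ge0.
Qed.

(** A singular [s%:M + M] has a nonzero left kernel vector, that is, a left eigenvector of [- M] for
    the real eigenvalue s, which forces s <= [spectral_abscissa (- M)] < 0. *)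
Lemma spectral_abscissa_lt0_unit M s : spectral_abscissa (- M) < 0 -> 0 <= s ->
  s%:M + M \in unitmx.
Proof.
move=> M_lt0 s0; rewrite unitmxE unitfE; apply/negP => /det0P [v v0 vM].
suff : s <= spectral_abscissa (- M) by lra.
rewrite /spectral_abscissa; apply: ub_le_sup; first exact: eigenvalue_Re_bounded.
exists (real_complex R s) => //=.
apply/eigenvalueP; exists (map_mx (real_complex R) v); last first.
  by rewrite map_mx_eq0.
rewrite -map_mxM -map_mxZ; congr map_mx; rewrite mulmxN.
by move: vM; rewrite mulmxDr mul_mx_scalar addrC => /eqP; rewrite addr_eq0 => /eqP ->;
  rewrite opprK.
Qed.

(* A zero entry of a nonnegative column x with positive image would give a
   nonpositive entry of the image. *)
Lemma Zmatrix_col_gt0 M (x : 'cV[R]_n) : (forall i j, i != j -> M i j <= 0) ->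
  (forall i, 0 <= x i 0) -> (forall i, 0 < (M *m x) i 0) -> forall i, 0 < x i 0.
Proof.
move=> M0 x0 Mx i; rewrite lt_neqAle x0 andbT; apply/negP => /eqP xi.
have := Mx i; rewrite ltNge => /negP; apply.
rewrite mxE; apply: sumr_le0 => j _.
have [<-|ij] := eqVneq i j; first by rewrite -xi mulr0.
by rewrite mulr_le0_ge0// M0.
Qed.

(** Minimum principle: let k minimise x_k / v_k. If this ratio r is negative, then y = x - r v is
    nonnegative, has y_k = 0 and satisfies M y > 0, which [Zmatrix_col_gt0] forbids. *)
Lemma Zmatrix_mono M (v x : 'cV[R]_n) : (forall i j, i != j -> M i j <= 0) ->
  (forall i, 0 < v i 0) -> (forall i, 0 < (M *m v) i 0) ->
  (forall i, 0 <= (M *m x) i 0) -> forall i, 0 <= x i 0.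
Proof.
move=> M0 v0 Mv Mx i.
pose r k := x k 0 / v k 0.
case: (arg_minP (i0 := i) (P := xpredT) r) => // k _ kmin.
rewrite leNgt; apply/negP => xi0.
have ri : r i < 0 by rewrite /r pmulr_llt0 ?invr_gt0.
have rk : r k < 0 := le_lt_trans (kmin i isT) ri.
pose y : 'cV[R]_n := x - r k *: v.
have y0 j : 0 <= y j 0.
  by rewrite !mxE subr_ge0 -ler_pdivlMr// kmin.
have := @Zmatrix_col_gt0 M y M0 y0 _ k; rewrite !mxE divfK ?gt_eqF ?v0// subrr ltxx => H.
suff: false by []. apply: H => j; rewrite /y mulmxBr -scalemxAr mxE.
rewrite [X in _ + X]mxE [X in _ - X]mxE subr_gt0 (lt_le_trans _ (Mx j))//.
by rewrite nmulr_rlt0.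
Qed.



(** Positivity of [v s] is both open and closed in s: a limit of positive solutions is nonnegative,
    and [Zmatrix_col_gt0] makes a nonnegative solution of [A s *m v s = e] positive. *)
Lemma hurwitz_Zmatrix_supersolution M : (forall i j, i != j -> M i j <= 0) ->
  (forall s, 0 <= s -> s%:M + M \in unitmx) ->
  exists v : 'cV[R]_n, (forall i, 0 < v i 0) /\ (forall i, 0 < (M *m v) i 0).
Proof.
move=> M0 uM.
pose A s := s%:M + M; pose e : 'cV[R]_n := const_mx 1.
pose v s := invmx (A s) *m e.
have Av s : 0 <= s -> A s *m v s = e.
  by move=> s0; rewrite mulmxA mulmxV ?mul1mx// uM.
have A0 s i j : i != j -> A s i j <= 0.
  by move=> ij; rewrite !mxE (negbTE ij) mulr0n add0r M0.
have v_strict s i : 0 <= s -> (forall j, 0 <= v s j 0) -> 0 < v s i 0.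
  move=> s0 vs; apply: (Zmatrix_col_gt0 (A0 s)) => // j.
  by rewrite Av// mxE.
pose PA : 'M[{poly R}]_n := 'X%:M + map_mx polyC M.
have PAE s : map_mx (horner_eval s) PA = A s.
  apply/matrixP => i j; rewrite !mxE /horner_eval !hornerE; congr (_ + _).
  by case: (i == j); rewrite ?mulr1n ?mulr0n ?hornerE.
(* By Cramer's rule this polynomial takes at s the value det(A s)^2 v_i(s). It has the sign of
   v_i(s), whatever the sign of the determinant, and its continuity is immediate. *)
pose W i := \det PA * (\adj PA *m const_mx 1 : 'cV_n) i 0.
have WE s i : 0 <= s -> (W i).[s] = (\det (A s)) ^+ 2 * v s i 0.
  move=> s0; rewrite hornerM -[_.[s]]/(horner_eval s _) -det_map_mx PAE.
  have -> : ((\adj PA *m const_mx 1 : 'cV_n) i 0).[s] =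
      map_mx (horner_eval s) (\adj PA *m const_mx 1 : 'cV_n) i 0 by rewrite [RHS]mxE.
  rewrite map_mxM map_mx_adj PAE.
  rewrite (_ : map_mx _ _ = e); last by apply/matrixP => k l; rewrite !mxE; exact: (hornerC 1 s).
  rewrite /v /invmx uM// -scalemxAl [in RHS]mxE expr2 -mulrA mulVKf//.
  by rewrite -unitfE -unitmxE uM.
have Wsg s i : 0 <= s -> ((W i).[s] < 0) = (v s i 0 < 0).
  move=> s0; rewrite WE// pmulr_rlt0// exprn_even_gt0//=.
  by rewrite -unitfE -unitmxE uM.
have Wsg' s i : 0 <= s -> (0 < (W i).[s]) = (0 < v s i 0).
  move=> s0; rewrite WE// pmulr_rgt0// exprn_even_gt0//=.
  by rewrite -unitfE -unitmxE uM.
(* S exceeds every absolute row sum of M, so for s >= S all row sums of [A s] are positive: the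
   constant vector [e] is then a supersolution, and [Zmatrix_mono] applies with it. *)
pose S := 1 + \sum_i \sum_j `|M i j|.
have vS s i : S <= s -> 0 < v s i 0.
  move=> Ss.
  have s0 : 0 < s.
    by rewrite (lt_le_trans _ Ss)// ltr_pwDl// sumr_ge0// => *; rewrite sumr_ge0.
  have es k : \sum_j A s k j > 0.
    under eq_bigr do rewrite mxE; rewrite big_split/= (bigD1 k)//= big1 ?addr0; last first.
      by move=> j jk; rewrite mxE eq_sym (negbTE jk) mulr0n.
    rewrite mxE eqxx mulr1n -ltrBlDr sub0r (lt_le_trans _ Ss)// (@le_lt_trans _ _ (\sum_j `|M k j|))//.
      by rewrite (le_trans (ler_norm _))// normrN ler_norm_sum.
    by rewrite /S [X in _ < 1 + X](bigD1 k)//= addrCA ltrDl ltr_pwDl// sumr_ge0// => *; rewrite sumr_ge0.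
  apply: v_strict; first exact: ltW.
  apply: (Zmatrix_mono (A0 s) (v := e)) => j.
  - by rewrite mxE.
  - rewrite mxE (eq_bigr (A s j)) ?es// => k _; by rewrite [e _ _]mxE mulr1.
  - by rewrite Av ?ltW// mxE.
pose B := [set s | 0 <= s /\ exists i, v s i 0 <= 0].
have [B0|B0] := pselect (B !=set0); last first.
  exists (v 0); have v0 i : 0 < v 0 i 0.
    by rewrite ltNge; apply/negP => vi; apply: B0; exists 0; split => //; exists i.
  have A0M : A 0 = M by rewrite /A raddf0 add0r.
  by split=> // i; have := Av 0 (lexx 0); rewrite A0M => ->; rewrite mxE.
exfalso.
have SB : ubound B S.
  move=> s [s0 [i vi]]; rewrite leNgt; apply/negP => /ltW /(vS s i).
  by rewrite ltNge vi.
have hB : has_sup B by split => //; exists S.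
pose s0 := sup B.
have s00 : 0 <= s0.
  by case: B0 => s Bs; rewrite (@le_trans _ _ s)//; [case: Bs|apply: ub_le_sup => //; exists S].
(* A negative entry at s0 would persist at s0 + r / 2, a point of B beyond its supremum. *)
have v0 i : 0 < v s0 i 0.
  apply: v_strict => // j; rewrite leNgt -Wsg//; apply/negP => W0.
  have /cvgr_lt /(_ 0 W0) : (W j).[x] @[x --> s0] --> (W j).[s0] by exact: continuous_horner.
  move=> /nbhs_ballP[r /= r0 /(_ (s0 + r / 2))].
  rewrite /ball/= opprD addNKr normrN gtr0_norm ?divr_gt0// ltr_pdivrMr// ltr_pMr// ltrDl ltr01 => /(_ isT).
  have sr : 0 <= s0 + r / 2 by rewrite addr_ge0// divr_ge0// ltW.
  rewrite Wsg// => /ltW H.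
  have : s0 + r / 2 <= s0 by apply: ub_le_sup; [exists S|split => //; exists j].
  by rewrite gerDl leNgt divr_gt0.
(* Conversely, positivity at s0 extends to a neighbourhood of s0, which must contain points of B. *)
have near_gt0 i : \forall s \near s0, 0 < (W i).[s].
  have /cvgr_gt : (W i).[x] @[x --> s0] --> (W i).[s0] by exact: continuous_horner.
  by apply; rewrite Wsg'.
have [r /= r0 H] := (nbhs_ballP _ _).1 (filter_forall (nbhs_filter s0) near_gt0).
have [s [ss [i vi]] sr] := sup_adherent r0 hB.
have := H s _ i; rewrite Wsg'// ltNge vi => F; suff: false by []; apply: F.
rewrite /ball/= ger0_norm ?subr_ge0; first by rewrite ltrBlDr addrC -ltrBlDr.
by apply: ub_le_sup; [exists S|split => //; exists i].
Qed.

End spectral.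

(** * Integrals with respect to laws and mixtures *)

Section laws.
Local Open Scope ereal_scope.
Context d d1 (T : measurableType d) (T1 : measurableType d1) (R : realType).

(** [m1] is the image under [phi] of m restricted to E, packaged as a finite measure so that
    uniqueness of product measures applies to it. *)
Lemma law_restr (m : {finite_measure set T -> \bar R}) (E : set T) (phi : T -> T1) :
  measurable E -> measurable_fun setT phi ->
  exists m1 : {finite_measure set T1 -> \bar R},
    (forall A, measurable A -> m1 A = m (E `&` phi @^-1` A)) /\
    forall f : T1 -> \bar R, (forall x, 0 <= f x) -> measurable_fun setT f ->
      \int[m]_(o in E) f (phi o) = \int[m1]_x f x.
Proof.
move=> mE mphi.
pose m0 : {measure set T1 -> \bar R} :=
  measure_function_pushforward__canonical__measure_function_Measure (mrestr m mE) mphi.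
have m0fin : fin_num_fun m0.
  move=> A mA; rewrite /m0/= /pushforward fin_num_measure//.
  by rewrite -[X in measurable X]setTI; exact: (mphi measurableT _ mA).
pose m1 : {finite_measure set T1 -> \bar R} := HB.pack (m0 : set T1 -> \bar R)
  (Measure.class m0) (Measure_isFinite.Build _ _ _ _ m0fin).
exists m1; split=> [A mA|f f0 mf]; first by rewrite /= /pushforward /mrestr setIC.
rewrite (ge0_integral_pushforward (phi := phi) mphi)//=.
rewrite preimage_setT (@ge0_negligible_integral _ _ _ _ setT (~` E))//.
- rewrite setTD setCK; apply: eq_measure_integral => A mA AE.
  by rewrite /= /mrestr setIidl.
- exact: measurableC.
- exact: measurableT_comp.
- by rewrite /= /mrestr setICl measure0.
Qed.


End laws.

Section indep.
Local Open Scope ereal_scope.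
Context d d1 d2 d' (T : measurableType d) (T1 : measurableType d1)
  (T2 : measurableType d2) (T' : measurableType d') (R : realType).

(** On E the joint law of phi and psi is a product on rectangles, hence a product measure, and
    Tonelli applies. The second factor lives on another space because it will be the law of the
    restarted process under [P 0 j], or a jump law. *)
Lemma integral_indep
    (m : {finite_measure set T -> \bar R}) (m' : {finite_measure set T' -> \bar R})
    (E : set T) (phi : T -> T1) (psi : T -> T2) (psi' : T' -> T2)
    (f : T1 -> \bar R) (g : T2 -> \bar R) :
  measurable E -> measurable_fun setT phi -> measurable_fun setT psi ->
  measurable_fun setT psi' ->
  (forall x, 0 <= f x) -> (forall y, 0 <= g y) ->
  measurable_fun setT f -> measurable_fun setT g ->
  (forall A B, measurable A -> measurable B ->
    m (E `&` (phi @^-1` A `&` psi @^-1` B)) =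
    m (E `&` phi @^-1` A) * m' (psi' @^-1` B)) ->
  \int[m]_(o in E) (f (phi o) * g (psi o)) =
  (\int[m]_(o in E) f (phi o)) * \int[m']_o g (psi' o).
Proof.
move=> mE mphi mpsi mpsi' f0 g0 mf mg indep.
have [m1 [m1E m1I]] := law_restr m mE mphi.
have [m2 [m2E m2I]] := law_restr m' measurableT mpsi'.
have [m12 [m12E m12I]] :=
  law_restr m mE (measurable_fun_pair mphi mpsi).
have mfg : measurable_fun setT (fun z : T1 * T2 => f z.1 * g z.2).
  by apply: emeasurable_funM; exact: measurableT_comp.
rewrite (m12I (fun z => f z.1 * g z.2)) => [|z|//]; last exact: mule_ge0.
rewrite m1I// m2I//.
transitivity (\int[m1 \x m2]_z (f z.1 * g z.2)).
  apply: eq_measure_integral => A mA _; apply/esym/product_measure_unique => //.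
  move=> B C mB mC; rewrite -[LHS]/(m12 (B `*` C)) -[X in _ = X * _]/(m1 B) -[X in _ = _ * X]/(m2 C).
  rewrite m12E; last exact: measurableX.
  by rewrite m1E// m2E// setTI -indep.
rewrite fubini_tonelli1 => [|//|z]; last exact: mule_ge0.
rewrite /fubini_F/=.
under eq_integral => x _ do rewrite ge0_integralZl//.
by rewrite ge0_integralZr// integral_ge0.
Qed.

End indep.

Section mixture.
Local Open Scope ereal_scope.
Context d1 d2 (S : measurableType d1) (T : measurableType d2) (R : realType).
Import HBNNSimple.

(** An identity known on sets passes to simple functions by linearity and to f by monotone
    convergence. It turns the exit laws, given as time integrals of a kernel, into Laplace
    transforms. *)
Lemma integral_mixture (nu : {measure set S -> \bar R}) (D : set S)
    (w : S -> R) (k : S -> {measure set T -> \bar R})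
    (m : {measure set T -> \bar R}) (f : T -> \bar R) :
  measurable D -> measurable_fun D w -> (forall s, D s -> (0 <= w s)%R) ->
  (forall A, measurable A -> measurable_fun setT (k ^~ A)) ->
  (forall A, measurable A -> m A = \int[nu]_(s in D) ((w s)%:E * k s A)) ->
  (forall x, 0 <= f x) -> measurable_fun setT f ->
  \int[m]_x f x = \int[nu]_(s in D) ((w s)%:E * \int[k s]_x f x).
Proof.
move=> mD mw w0 mk mE f0 mf.
have mwk A : measurable A -> measurable_fun D (fun s => (w s)%:E * k s A).
  move=> mA; apply: emeasurable_funM; first exact/measurable_EFinP.
  exact: measurable_funTS (mk _ mA).
pose f_ := nnsfun_approx measurableT mf.
have f_cvg (mu : {measure set T -> \bar R}) :
    \int[mu]_x (f_ n x)%:E @[n --> \oo] --> \int[mu]_x f x.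
  have := @cvg_monotone_convergence _ _ _ mu setT measurableT (fun n x => (f_ n x)%:E).
  have -> : (fun x => limn (fun n => (f_ n x)%:E)) = f.
    by apply/funext => x; apply/cvg_lim => //; exact: cvg_nnsfun_approx.
  apply.
  - by move=> n; exact/measurable_EFinP.
  - by move=> n x _; rewrite lee_fin.
  - by move=> x _ a b ab; rewrite lee_fin; exact/lefP/nd_nnsfun_approx.
have intf_ (mu : {measure set T -> \bar R}) n :
   \int[mu]_x (f_ n x)%:E = \sum_(r \in range (f_ n)) (r%:E * mu (f_ n @^-1` [set r])).
  by rewrite integralT_nnsfun sintegralE.
have r0 n r : range (f_ n) r -> (0 <= r)%R by move=> [x _ <-].
have step n : \int[m]_x (f_ n x)%:E = \int[nu]_(s in D) ((w s)%:E * \int[k s]_x (f_ n x)%:E).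
  rewrite intf_.
  transitivity (\sum_(r \in range (f_ n)) \int[nu]_(s in D) (r%:E * ((w s)%:E * k s (f_ n @^-1` [set r])))).
    apply: eq_fsbigr => r /[!inE] /r0 rn0; rewrite mE// ge0_integralZl_EFin//; last exact: mwk.
    by move=> s Ds; rewrite mule_ge0// lee_fin w0.
  rewrite -ge0_integral_fsum//.
  - apply: eq_integral => s /[!inE] Ds; rewrite intf_ ge0_mule_fsumr.
      by apply: eq_fsbigr => r _; rewrite muleCA.
    by move=> r; exact: nnsfun_mulemu_ge0.
  - by move=> r; apply: measurable_funeM; exact: mwk.
  - move=> r s Ds; rewrite muleCA mule_ge0 ?lee_fin ?w0//.
    exact: nnsfun_mulemu_ge0.
have mf_ n : measurable_fun setT (fun x => (f_ n x)%:E) by exact/measurable_EFinP.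
have mint n : measurable_fun D (fun s => (w s)%:E * \int[k s]_x (f_ n x)%:E).
  apply: emeasurable_funM; first exact/measurable_EFinP.
  apply: measurable_funTS; apply: measurable_fun_integral_kernel => // x.
  by rewrite lee_fin.
have le_f_ s a b : (a <= b)%N -> \int[k s]_x (f_ a x)%:E <= \int[k s]_x (f_ b x)%:E.
  move=> ab; apply: ge0_le_integral => // [x _|x _]; rewrite lee_fin//.
  exact/lefP/nd_nnsfun_approx.
have int0 s n : 0 <= \int[k s]_x (f_ n x)%:E.
  by apply: integral_ge0 => x _; rewrite lee_fin.
apply/esym; transitivity (\int[nu]_(s in D) limn (fun n => (w s)%:E * \int[k s]_x (f_ n x)%:E)).
  apply: eq_integral => s _; apply/esym/cvg_lim => //.
  by apply: cvgeZl => //; exact: f_cvg.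
rewrite monotone_convergence//.
- by under eq_fun do rewrite -step; apply/cvg_lim => //; exact: f_cvg.
- by move=> n s Ds; rewrite mule_ge0// lee_fin w0.
- by move=> s Ds a b ab; rewrite lee_pmul ?lee_fin ?w0// le_f_.
Qed.

End mixture.

(** * Power series with nonnegative coefficients *)

Lemma measurable_expRM (R : realType) (D : set (measurableTypeR R)) (p : R) :
  measurable_fun D (fun x : measurableTypeR R => expR (- (p * x))).
Proof.
by apply: measurableT_comp => //; apply: measurable_funN; exact: measurable_funM.
Qed.

Section power_series.
Variable R : realType.
Implicit Types (a b : nat -> R) (u : R).

Definition psum a u : \bar R := (\sum_(n <oo) (a n * u ^+ n)%:E)%E.

Definition conv a b n : R := \sum_(k < n.+1) a k * b (n - k)%N.

Lemma conv_ge0 a b : (forall n, 0 <= a n) -> (forall n, 0 <= b n) ->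
  forall n, 0 <= conv a b n.
Proof. by move=> a0 b0 n; apply: sumr_ge0 => k _; exact: mulr_ge0. Qed.

Lemma psum_ge0 a u : (forall n, 0 <= a n) -> 0 <= u -> (0 <= psum a u)%E.
Proof.
by move=> a0 u0; apply: nneseries_ge0 => n _ _; rewrite lee_fin mulr_ge0// exprn_ge0.
Qed.

Lemma le_psum a u v : (forall n, 0 <= a n) -> 0 <= u -> u <= v ->
  (psum a u <= psum a v)%E.
Proof.
move=> a0 u0 uv; apply: lee_nneseries => n _; rewrite lee_fin.
  by rewrite mulr_ge0// exprn_ge0.
by rewrite ler_wpM2l// lerXn2r// nnegrE// (le_trans u0).
Qed.

(** Cauchy product by Tonelli: the array [f k n], zero for n < k, is summed in both orders. *)
Lemma psumM a b u : (forall n, 0 <= a n) -> (forall n, 0 <= b n) -> 0 <= u ->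
  psum b u \is a fin_num -> psum (conv a b) u = (psum a u * psum b u)%E.
Proof.
move=> a0 b0 u0 psb.
pose f k n := if (k <= n)%N then a k * u ^+ k * (b (n - k)%N * u ^+ (n - k)) else 0.
have u0' k : 0 <= u ^+ k by rewrite exprn_ge0.
have f0 k n : (0 <= (f k n)%:E)%E by rewrite /f; case: ifP => // _; rewrite lee_fin !mulr_ge0.
transitivity (\sum_(n <oo) \sum_(k <oo) (f k n)%:E)%E.
  apply: eq_eseriesr => n _.
  rewrite (nneseries_split 0 n.+1)// add0n [X in (_ + X)%E]eseries0 ?adde0; last first.
    by move=> k /= kn _; rewrite /f leqNgt kn.
  rewrite sumEFin big_mkord mulr_suml; congr (_%:E); apply: eq_bigr => k _.
  have kn : (k <= n)%N by rewrite -ltnS.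
  have -> : u ^+ n = u ^+ k * u ^+ (n - k) by rewrite -exprD subnKC.
  by rewrite /f kn; ring.
rewrite nneseries_interchange//.
transitivity (\sum_(k <oo) ((a k * u ^+ k)%:E * psum b u))%E.
  apply: eq_eseriesr => k _.
  rewrite -nneseriesZl; last by move=> n _; rewrite lee_fin mulr_ge0.
  rewrite (nneseries_split 0 k)// add0n big1_seq ?add0e; last first.
    by move=> n /andP[_]; rewrite mem_index_iota/= => nk; rewrite /f leqNgt nk.
  rewrite -nneseries_addn//; apply: eq_eseriesr => n _.
  by rewrite /f leq_addl addnK EFinM.
rewrite -(fineK psb) muleC -nneseriesZl; last first.
  by move=> n _; rewrite lee_fin mulr_ge0.
by apply: eq_eseriesr => k _; rewrite muleC.
Qed.

(** Cancelling the first N terms and dividing by u^N leaves a_N <= b_N + u C with C = [psum b 1];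
    then u tends to 0. The equality of coefficients follows by exchanging a and b. *)
Lemma psum_le_tail a b N : (forall n, 0 <= a n) -> (forall n, 0 <= b n) ->
  (psum b 1 < +oo)%E -> (forall u, 0 <= u -> u <= 1 -> psum a u = psum b u) ->
  (forall n, (n < N)%N -> a n = b n) -> a N <= b N.
Proof.
move=> a0 b0 bfin ab abN.
pose C := fine (psum b 1).
have CE : psum b 1 = C%:E by rewrite fineK// ge0_fin_numE// psum_ge0.
have C0 : 0 <= C by rewrite -lee_fin -CE psum_ge0.
have le u : 0 < u -> u <= 1 -> a N <= b N + u * C.
  move=> u0 u1.
  have t0 c k : (forall n, 0 <= c n) -> (0 <= (c k * u ^+ k)%:E)%E.
    by move=> c0; rewrite lee_fin mulr_ge0// exprn_ge0// ltW.
  have := ab u (ltW u0) u1; rewrite /psum.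
  rewrite (nneseries_split 0 N)//; last by move=> k _; exact: t0.
  rewrite [in RHS](nneseries_split 0 N)//; last by move=> k _; exact: t0.
  rewrite add0n !sumEFin.
  have -> : \sum_(0 <= i < N) a i * u ^+ i = \sum_(0 <= i < N) b i * u ^+ i.
    by apply: eq_big_nat => i /andP[_ iN]; rewrite abN.
  move=> /eqP; rewrite eq_le leeD2lE// => /andP[+ _].
  rewrite (nneseries_split N 1)//; last by move=> k _; exact: t0.
  rewrite [in leRHS](nneseries_split N 1)//; last by move=> k _; exact: t0.
  rewrite addn1 !big_nat1 => tails.
  have ta : (0 <= \sum_(N.+1 <= k <oo) (a k * u ^+ k)%:E)%E.
    by apply: nneseries_ge0 => k _ _; exact: t0.
  have tb : (\sum_(N.+1 <= k <oo) (b k * u ^+ k)%:E <= (u ^+ N.+1 * C)%:E)%E.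
    rewrite EFinM -CE /psum -nneseriesZl; last by move=> k _; rewrite expr1n mulr1 lee_fin.
    rewrite [leRHS](nneseries_split 0 N.+1)//; last first.
      by move=> k _; rewrite expr1n mulr1 lee_fin mulr_ge0// exprn_ge0// ltW.
    rewrite add0n -[leLHS]add0e leeD//.
      by apply: sume_ge0 => k _; rewrite expr1n mulr1 lee_fin mulr_ge0// exprn_ge0// ltW.
    rewrite -(@nneseries_addn _ (fun k => (b k * u ^+ k)%:E)); last by move=> k; exact: t0.
    rewrite -(@nneseries_addn _ (fun k => (u ^+ N.+1)%:E * (b k * 1 ^+ k)%:E)%E); last first.
      by move=> k; rewrite -EFinM lee_fin expr1n mulr1 mulr_ge0// exprn_ge0// ltW.
    apply: lee_nneseries => k _; first by move=> _; exact: t0.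
    rewrite expr1n mulr1 -EFinM lee_fin mulrC ler_wpM2r//.
    by rewrite ler_wiXn2l ?leq_addl// ltW.
  have : ((a N * u ^+ N)%:E <= (b N * u ^+ N + u ^+ N.+1 * C)%:E)%E.
    rewrite EFinD (@le_trans _ _ ((a N * u ^+ N)%:E + \sum_(N.+1 <= k <oo) (a k * u ^+ k)%:E))%E ?leeDl//.
    by rewrite (le_trans tails)// leeD2l.
  have -> : b N * u ^+ N + u ^+ N.+1 * C = (b N + u * C) * u ^+ N by rewrite exprS; ring.
  by rewrite lee_fin ler_pM2r// exprn_gt0.
rewrite leNgt; apply/negP => ba.
(* This choice gives u C <= (a_N - b_N) / 2, against the previous bound; C + 1 keeps the denominator
   positive when C = 0. *)
pose u := Num.min 1 ((a N - b N) / (2 * (C + 1))).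
have u0 : 0 < u by rewrite lt_min ltr01 divr_gt0 ?subr_gt0// mulr_gt0// ltr_wpDl.
have := le u u0; rewrite ge_min lexx => /(_ isT).
have : u * C <= (a N - b N) / 2.
  rewrite (@le_trans _ _ ((a N - b N) / (2 * (C + 1)) * C))//.
    by rewrite ler_wpM2r// ge_min lexx orbT.
  rewrite invfM mulrA -mulrA ler_piMr//; first by rewrite divr_ge0// subr_ge0 ltW.
  by rewrite mulrC ler_pdivrMr ?ltr_wpDl// mul1r lerDl.
lra.
Qed.

Lemma psum_coef_inj a b : (forall n, 0 <= a n) -> (forall n, 0 <= b n) ->
  (psum b 1 < +oo)%E -> (forall u, 0 <= u -> u <= 1 -> psum a u = psum b u) -> a = b.
Proof.
move=> a0 b0 bfin ab; apply/funext => n; elim/ltn_ind: n => n IH.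
apply/eqP; rewrite eq_le !(@psum_le_tail _ _ n)//.
- by rewrite ab.
- by move=> u ? ?; rewrite ab.
- by move=> k /IH.
Qed.

(** Tonelli again, the coefficients being summed over k; finiteness at a single u > 0 makes each of
    these sums a real number. *)
Lemma psum_mono_lim (a : nat -> nat -> R) u : (forall k n, 0 <= a k n) -> 0 < u ->
  (\sum_(k <oo) psum (a k) u < +oo)%E ->
  exists2 b : nat -> R, (forall n, 0 <= b n) & forall v, 0 <= v -> v <= u ->
    psum b v = (\sum_(k <oo) psum (a k) v)%E.
Proof.
move=> a0 u0 fin.
have a0' k n : (0 <= (a k n)%:E)%E by rewrite lee_fin.
have bfin n : (\sum_(k <oo) (a k n)%:E < +oo)%E.
  rewrite ltey; apply/eqP => by_.
  move: fin; rewrite nneseries_interchange; last first.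
    by move=> k m; rewrite lee_fin mulr_ge0// exprn_ge0// ltW.
  rewrite (nneseriesD1 (n := n))//; last first.
    by move=> k _; apply: nneseries_ge0 => m _ _; rewrite lee_fin mulr_ge0// exprn_ge0// ltW.
  rewrite (_ : (\sum_(i <oo) (a i n * u ^+ n)%:E)%E = +oo%E) ?addye ?ltxx//.
    rewrite -ltNye (@lt_le_trans _ _ 0%E)//; apply: nneseries_ge0 => k _ _.
    by apply: nneseries_ge0 => m _ _; rewrite lee_fin mulr_ge0// exprn_ge0// ltW.
  under eq_eseriesr do rewrite mulrC EFinM.
  by rewrite nneseriesZl// by_ gt0_muley// lte_fin exprn_gt0.
exists (fun n => fine (\sum_(k <oo) (a k n)%:E)%E).
  by move=> n; rewrite fine_ge0// nneseries_ge0.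
move=> v v0 vu; rewrite nneseries_interchange; last first.
  by move=> k m; rewrite lee_fin mulr_ge0// exprn_ge0.
apply: eq_eseriesr => n _.
rewrite mulrC EFinM fineK; last by rewrite ge0_fin_numE// nneseries_ge0.
by rewrite -nneseriesZl//; apply: eq_eseriesr => k _; rewrite -EFinM mulrC.
Qed.

Lemma expR_nneseries (x : R) : 0 <= x ->
  (\sum_(n <oo) (x ^+ n / n`!%:R)%:E)%E = (expR x)%:E.
Proof.
move=> x0; apply/cvg_lim => //; under eq_fun do rewrite sumEFin.
apply: cvg_EFin; first by near=> n.
by have := is_cvg_series_exp_coeff x; rewrite /expR /exp_coeff.
Unshelve. all: by end_near. Qed.

(** Coefficients of the k-th power of the series with coefficients s, [exp] standing for exponent;
    the base case is the constant series 1. *)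
Fixpoint conv_exp s k : nat -> R :=
  if k is k'.+1 then conv (conv_exp s k') s else fun n => (n == 0)%:R.

Lemma psum_expR (s : nat -> R) u : (forall n, 0 <= s n) -> 0 < u ->
  (psum s u < +oo)%E ->
  exists2 b : nat -> R, (forall n, 0 <= b n) & forall v, 0 <= v -> v <= u ->
    psum b v = (expR (fine (psum s v)))%:E.
Proof.
move=> s0 u0 su.
have sv v : 0 <= v -> v <= u -> psum s v \is a fin_num.
  by move=> v0 vu; rewrite ge0_fin_numE ?psum_ge0// (le_lt_trans _ su)// le_psum.
have c0 k n : 0 <= conv_exp s k n.
  by elim: k n => [|k IH] n /=; [rewrite ler0n|exact: conv_ge0].
have cE k v : 0 <= v -> v <= u -> psum (conv_exp s k) v = (fine (psum s v) ^+ k)%:E.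
  move=> v0 vu; elim: k => [|k IH] /=.
    rewrite /psum (nneseries_split 0 1)//; last first.
      by move=> k _; rewrite lee_fin mulr_ge0// exprn_ge0.
    rewrite add0n big_nat1 eqxx mul1r expr0 eseries0 ?adde0//.
    by move=> [|i]// _ _; rewrite mul0r.
  by rewrite psumM ?sv// IH exprSr EFinM fineK ?sv.
have aE k v : 0 <= v -> v <= u ->
    psum (fun n => conv_exp s k n / k`!%:R) v = (fine (psum s v) ^+ k / k`!%:R)%:E.
  move=> v0 vu; rewrite mulrC EFinM -cE// -nneseriesZl; last first.
    by move=> n _; rewrite lee_fin mulr_ge0// exprn_ge0.
  by apply: eq_eseriesr => n _; rewrite -EFinM mulrA [(_ / _)%R]mulrC.
have sE v : 0 <= v -> v <= u -> (\sum_(k <oo) psum (fun n => (conv_exp s k n / k`!%:R)%R) v)%E =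
    (expR (fine (psum s v)))%:E.
  move=> v0 vu; rewrite -expR_nneseries; last by rewrite fine_ge0// psum_ge0.
  by apply: eq_eseriesr => k _; rewrite aE.
have a0 k n : 0 <= conv_exp s k n / k`!%:R by rewrite divr_ge0.
have aU : (\sum_(k <oo) psum (fun n => (conv_exp s k n / k`!%:R)%R) u < +oo)%E.
  by rewrite sE ?ltry// ltW.
have [b b0 bE] := psum_mono_lim a0 u0 aU.
by exists b => // v v0 vu; rewrite bE//; exact: sE.
Qed.

(** The coefficients are w_n times the integrals of e^{-x} x^n, real because of the finiteness at U;
    the conclusion then covers every u >= 0, both sides being possibly +oo. It serves with h = exp
    for laws and h = exp - 1 for Levy measures, whose mass may be infinite. *)
Lemma laplace_psum (nu : {measure set (measurableTypeR R) -> \bar R})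
    (D : set (measurableTypeR R))
    (w : nat -> R) (h : R -> R) U :
  measurable D -> (forall x, D x -> 0 <= x) -> (forall n, 0 <= w n) -> 0 < U ->
  (forall x, 0 <= x -> (h x)%:E = (\sum_(n <oo) (w n * x ^+ n)%:E)%E) ->
  (\int[nu]_(x in D) (expR (- x) * h (U * x))%:E < +oo)%E ->
  exists2 a : nat -> R, (forall n, 0 <= a n) & forall u, 0 <= u ->
    (\int[nu]_(x in D) (expR (- x) * h (u * x))%:E)%E = psum a u.
Proof.
move=> mD D0 w0 U0 hE hU.
pose t n (x : measurableTypeR R) := (expR (- x) * (w n * x ^+ n))%:E.
have t0 n x : D x -> (0 <= t n x)%E.
  by move=> Dx; rewrite lee_fin mulr_ge0 ?expR_ge0// mulr_ge0// exprn_ge0// D0.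
have mt n : measurable_fun D (t n).
  apply/measurable_EFinP; apply: measurable_funTS; apply: measurable_funM.
    by apply: measurableT_comp => //; exact: measurable_funN.
  by apply: measurable_funM => //; exact: measurable_funX.
have intE u : 0 <= u -> (\int[nu]_(x in D) (expR (- x) * h (u * x))%:E)%E =
    (\sum_(n <oo) ((u ^+ n)%:E * \int[nu]_(x in D) t n x))%E.
  move=> u0; have un n : 0 <= u ^+ n by rewrite exprn_ge0.
  pose g n (x : measurableTypeR R) : \bar R := ((u ^+ n)%:E * t n x)%E.
  have g0 n x : D x -> (0 <= g n x)%E by move=> Dx; apply: mule_ge0; [rewrite lee_fin|exact: t0].
  have mg n : measurable_fun D (g n) by exact: measurable_funeM.
  rewrite (eq_integral (fun x : measurableTypeR R => \sum_(n <oo) g n x)%E); last first.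
    move=> x /[!inE] Dx; rewrite EFinM hE; last by rewrite mulr_ge0// D0.
    rewrite -nneseriesZl => [|n _]; last first.
      by rewrite lee_fin mulr_ge0// exprn_ge0// mulr_ge0// D0.
    by apply: eq_eseriesr => n _; rewrite -!EFinM exprMn; congr EFin; ring.
  rewrite (integral_nneseries nu mD mg g0).
  by apply: eq_eseriesr => n _; rewrite ge0_integralZl_EFin//; exact: t0.
have int0 n : (0 <= \int[nu]_(x in D) t n x)%E by apply: integral_ge0 => x; exact: t0.
have fint n : (\int[nu]_(x in D) t n x \is a fin_num)%E.
  rewrite ge0_fin_numE// ltey; apply/eqP => tn.
  move: hU; rewrite intE ?ltW// (nneseriesD1 (n := n))//; last first.
    by move=> k _; rewrite mule_ge0// lee_fin exprn_ge0// ltW.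
  rewrite tn gt0_muley ?lte_fin ?exprn_gt0// addye ?ltxx//.
  rewrite -ltNye (@lt_le_trans _ _ 0%E)// nneseries_ge0// => k _ _.
  by rewrite mule_ge0// lee_fin exprn_ge0// ltW.
exists (fun n => fine (\int[nu]_(x in D) t n x)%E) => [n|u u0].
  by rewrite fine_ge0.
rewrite intE//; apply: eq_eseriesr => n _.
by rewrite mulrC EFinM fineK.
Qed.

End power_series.

(** * The Laplace transform of a subordinator at negative arguments *)

Section laplace.
Context (R : realType) (K : nat) (ch : characteristics R K).
Implicit Types (i j : 'I_K) (p q : R).

Lemma integral_jump_diag i q :
  (\int[jump ch i i]_(x in `[0%R, +oo[) (expR (- (q * x)))%:E = 1)%E.
Proof.
rewrite (eq_measure_integral (\d_(0 : measurableTypeR R))) => [|A mA _]; last exact: jump_diag.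
rewrite integral_dirac//; last by apply/measurable_EFinP; exact: measurable_expRM.
by rewrite mulr0 oppr0 expR0 mule1 diracE mem_set//= in_itv/= lexx.
Qed.

(** Some admissible q < p exists, and the integrands decrease in p. A zero rate gives no information
    on the jump law, since 0 times +oo is 0. *)
Lemma p_lower_lt p : (p_lower ch < p%:E)%E ->
  (forall i, p < 0 -> (\int[levy ch i]_(x in `]0%R, +oo[) (expR (- (p * x)) - 1)%:E < +oo)%E) /\
  (forall i j, rate ch i j != 0 -> (\int[jump ch i j]_(x in `[0%R, +oo[) (expR (- (p * x)))%:E < +oo)%E).
Proof.
move=> /ereal_inf_lt [_ [q [q1 q2] <-]]; rewrite lte_fin => qp.
split=> [i p0|i j rij].
  apply: le_lt_trans (q1 i); apply: ge0_le_integral => //.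
  - move=> x; rewrite /= in_itv/= andbT => x0.
    by rewrite lee_fin subr_ge0 -expR0 ler_expR oppr_ge0 nmulr_rle0// ltW.
  - apply/measurable_EFinP; apply: measurable_funB => //; exact: measurable_expRM.
  - apply/measurable_EFinP; apply: measurable_funB => //; exact: measurable_expRM.
  - move=> x; rewrite /= in_itv/= andbT => x0.
    by rewrite lee_fin lerB// ler_expR lerN2 ler_wpM2r// ltW.
have fin : (\int[jump ch i j]_(x in `[0%R, +oo[) (expR (- (q * x)))%:E < +oo)%E.
  (* On the diagonal the rate is negative, and the condition on q would tolerate an infinite
     integral; the law is a Dirac mass at 0 there. *)
  have [ij|ij] := eqVneq i j.
    by rewrite -ij integral_jump_diag ltry.
  have := q2 i j; rewrite ltey => H; rewrite ltey; apply: contra_neq H => ->.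
  by rewrite gt0_muley// lte_fin lt_neqAle eq_sym rij rate_ge0.
apply: le_lt_trans fin; apply: ge0_le_integral => //.
- by apply/measurable_EFinP; exact: measurable_expRM.
- by apply/measurable_EFinP; exact: measurable_expRM.
- move=> x; rewrite /= in_itv/= andbT => x0.
  by rewrite lee_fin ler_expR lerN2 ler_wpM2r// ltW.
Qed.

Lemma levy_integrable i q : (p_lower ch < q%:E)%E ->
  (levy ch i).-integrable `]0%R, +oo[ (fun x => (1 - expR (- (q * x)))%:E).
Proof.
move=> pq.
have mq : measurable_fun (`]0, +oo[%classic : set (measurableTypeR R))
    (fun x : measurableTypeR R => 1 - expR (- (q * x))).
  by apply: measurable_funB => //; exact: measurable_expRM.
apply/integrableP; split; first exact/measurable_EFinP.
have [q0|q0] := leP 0 q; last first.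
  apply: le_lt_trans ((p_lower_lt pq).1 i q0).
  rewrite le_eqVlt; apply/orP; left; apply/eqP; apply: eq_integral => x.
  rewrite inE/= in_itv/= andbT => x0.
  by rewrite /= ler0_norm ?opprB// subr_le0 -expR0 ler_expR oppr_ge0 nmulr_rle0// ltW.
have mmin : measurable_fun (`]0, +oo[%classic : set (measurableTypeR R))
    (fun x : measurableTypeR R => (Num.min 1 x)%:E).
  by apply/measurable_EFinP; exact: measurable_minr.
(* For q >= 0, 1 - e^{-qx} is at most both 1 and q x, hence at most (q + 1) min(1, x). *)
have : (\int[levy ch i]_(x in `]0%R, +oo[) ((q + 1)%:E * (Num.min 1 x)%:E) < +oo)%E.
  rewrite ge0_integralZl_EFin//; first by rewrite lte_mul_pinfty ?lee_fin ?addr_ge0// levy_fin.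
    by move=> x; rewrite /= in_itv/= andbT => x0; rewrite lee_fin le_min ler01 ltW.
  by rewrite addr_ge0.
apply: le_lt_trans; apply: ge0_le_integral => //.
- by apply: measurableT_comp => //; exact/measurable_EFinP.
- exact: measurable_funeM.
move=> x; rewrite /= in_itv/= andbT => x0.
have e1 : expR (- (q * x)) <= 1 by rewrite -expR0 ler_expR oppr_le0 mulr_ge0// ltW.
have e0 : 0 < expR (- (q * x)) by exact: expR_gt0.
have e2 : 1 - q * x <= expR (- (q * x)) by exact: expR_ge1Dx.
rewrite ger0_norm ?subr_ge0// -EFinM lee_fin /Num.min; case: ifP => x1; nra.
Qed.


(** psi(1) - psi(1 - u) is c u plus the integral of e^{-x} (e^{ux} - 1) against the Levy measure:
    the killing rate cancels and the drift is the coefficient of index 1. *)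
Lemma laplace_exponent_psum i p : (p_lower ch < p%:E)%E -> p < 0 ->
  exists2 s : nat -> R, (forall n, 0 <= s n) & forall u, 0 <= u -> u <= 1 - p ->
    psum s u = (laplace_exponent ch i 1 - laplace_exponent ch i (1 - u))%:E.
Proof.
move=> pp p0.
pose h (x : R) := expR x - 1.
pose w n : R := if n is 0 then 0 else n`!%:R^-1.
have w0 n : 0 <= w n by case: n => //= n; rewrite invr_ge0.
have hE x : 0 <= x -> (h x)%:E = (\sum_(n <oo) (w n * x ^+ n)%:E)%E.
  move=> x0; rewrite /h EFinB -expR_nneseries//.
  rewrite (nneseries_split 0 1)// => [|n _]; last by rewrite lee_fin divr_ge0// exprn_ge0.
  rewrite [in RHS](nneseries_split 0 1)// => [|n _]; last by rewrite lee_fin mulr_ge0// exprn_ge0.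
  rewrite !add0n !big_nat1 /= expr0 fact0 divr1 mul0r add0e addeAC subee// add0e.
  apply/congr_lim/funext => m; apply: eq_big_nat; case=> // n _.
  by rewrite /= mulrC.
have intE u : 0 <= u -> u <= 1 - p ->
    (\int[levy ch i]_(x in `]0%R, +oo[) (expR (- x) * h (u * x))%:E)%E =
    ((\int[levy ch i]_(x in `]0, +oo[) (1 - expR (- (1 * x)))) -
     (\int[levy ch i]_(x in `]0, +oo[) (1 - expR (- ((1 - u) * x)))))%:E.
  move=> u0 u1.
  have I1 : (levy ch i).-integrable `]0%R, +oo[ (EFin \o (fun x => 1 - expR (- (1 * x)))).
    apply: levy_integrable; apply: lt_le_trans pp _; rewrite lee_fin; lra.
  have I2 : (levy ch i).-integrable `]0%R, +oo[ (EFin \o (fun x => 1 - expR (- ((1 - u) * x)))).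
    apply: levy_integrable; apply: lt_le_trans pp _; rewrite lee_fin; lra.
  rewrite -RintegralB// /Rintegral.
  have ee (x : R) : expR (- x) * h (u * x) =
      1 - expR (- (1 * x)) - (1 - expR (- ((1 - u) * x))).
    have e1 : expR (- x) * expR (u * x) = expR (- ((1 - u) * x)).
      by rewrite -expRD; congr expR; ring.
    by rewrite /h mul1r mulrBr e1; ring.
  under [in LHS]eq_integral do rewrite ee.
  rewrite fineK//.
  under eq_integral do rewrite EFinB.
  rewrite integralB_EFin// fin_numB !integrable_fin_num//.
have U0 : 0 < 1 - p by lra.
have [|||a a0 aE] := @laplace_psum _ (levy ch i) `]0, +oo[%classic w h (1 - p) _ _ w0 U0 hE.
- exact: measurable_itv.
- by move=> x; rewrite /= in_itv/= andbT => /ltW.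
- by rewrite intE ?ltry// ltW.
exists (fun n => drift ch i * (n == 1)%:R + a n).
  by move=> n; rewrite addr_ge0// mulr_ge0// drift_ge0.
move=> u u0 u1; rewrite /psum.
under eq_eseriesr do rewrite mulrDl EFinD.
rewrite nneseriesD; last 2 first.
  by move=> n _ _; rewrite lee_fin !mulr_ge0 ?drift_ge0 ?ler0n ?exprn_ge0.
  by move=> n _ _; rewrite lee_fin mulr_ge0 ?exprn_ge0.
rewrite -/(psum a u) -aE// intE// (nneseriesD1 (n := 1))//; last first.
  by move=> n _; rewrite lee_fin !mulr_ge0 ?drift_ge0 ?ler0n ?exprn_ge0.
rewrite eseries0 ?adde0; last first.
  by move=> n _ /andP[_ /negbTE ->]; rewrite mulr0 mul0r.
rewrite eqxx mulr1 expr1 -EFinD; congr EFin; rewrite /laplace_exponent; ring.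
Qed.

(** exp(- t psi(1 - u)) is exp(- t psi(1)) times the exponential of a series with nonnegative
    coefficients that converges up to u = 1 - p. The integral has the same coefficients, so its
    finiteness at p is part of the conclusion. *)
Lemma subordinator_laplace i (mu : R.-spker (measurableTypeR R) ~> (measurableTypeR R)) p t :
  subordinator_laws (laplace_exponent ch i) mu -> (p_lower ch < p%:E)%E -> 0 <= t ->
  (\int[mu t]_(x in `[0%R, +oo[) (expR (- (p * x)))%:E)%E =
  (expR (- (t * laplace_exponent ch i p)))%:E.
Proof.
move=> mulaw pp t0; have [_ L] := mulaw t t0.
have [p0|p0] := leP 0 p; first exact: L.
have [s s0 sE] := laplace_exponent_psum i pp p0.
have U0 : 0 < 1 - p by lra.
pose ts n := t * s n.
have ts0 n : 0 <= ts n by rewrite mulr_ge0.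
have tsE u : 0 <= u -> u <= 1 - p ->
    psum ts u = (t * (laplace_exponent ch i 1 - laplace_exponent ch i (1 - u)))%:E.
  move=> u0 u1; rewrite EFinM -sE// -nneseriesZl; last first.
    by move=> n _; rewrite lee_fin mulr_ge0// exprn_ge0.
  by apply: eq_eseriesr => n _; rewrite -EFinM mulrA.
have [|b b0 bE] := psum_expR ts0 U0; first by rewrite tsE ?ltry// ltW.
have expE u : 0 <= u -> u <= 1 - p ->
   psum (fun n => expR (- (t * laplace_exponent ch i 1)) * b n) u =
   (expR (- (t * laplace_exponent ch i (1 - u))))%:E.
  move=> u0 u1; rewrite (_ : psum _ u = (expR (- (t * laplace_exponent ch i 1)))%:E * psum b u)%E; last first.
    rewrite -nneseriesZl; last by move=> n _; rewrite lee_fin mulr_ge0// exprn_ge0.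
    by apply: eq_eseriesr => n _; rewrite -EFinM mulrA.
  rewrite bE// tsE//= -EFinM -expRD; congr (expR _)%:E; ring.
have ee u x : expR (- x) * expR (u * x) = expR (- ((1 - u) * x)) :> R.
  by rewrite -expRD mulrBl mul1r opprB addrC.
(* The point U = 1 corresponds to the argument 0, where the integral is known to be finite. *)
have [|||||a a0 aE] := @laplace_psum _ (mu t) `[0, +oo[%classic (fun n => n`!%:R^-1) expR 1 _ _ _ ltr01.
- exact: measurable_itv.
- by move=> x; rewrite /= in_itv/= andbT.
- by move=> n; rewrite invr_ge0.
- move=> x x0; rewrite -expR_nneseries//.
  by apply: eq_eseriesr => n _; rewrite mulrC.
- by under eq_integral do rewrite ee; rewrite L ?subrr ?ltry.
have ab : a = (fun n => expR (- (t * laplace_exponent ch i 1)) * b n).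
  apply: psum_coef_inj => //.
  - by move=> n; rewrite mulr_ge0// expR_ge0.
  - by rewrite expE ?ltry//; lra.
  move=> u u0 u1; rewrite expE//; last by lra.
  rewrite -aE//; under eq_integral do rewrite ee.
  by apply: L; lra.
have p1 : 1 - (1 - p) = p by ring.
transitivity (\int[mu t]_(x in `[0%R, +oo[) (expR (- x) * expR ((1 - p) * x))%:E)%E.
  by apply: eq_integral => x _; rewrite ee p1.
by rewrite aE ?(ltW U0)// ab (expE _ (ltW U0) (lexx _)) p1.
Qed.

End laplace.

(** * Path functionals *)

Section half_line_limits.
Variable R : realType.
Implicit Type f : R -> \bar R.

Lemma nondecreasing_lim_at_left f s : 0 < s ->
  (forall a b, 0 <= a -> a <= b -> (f a <= f b)%E) ->
  lim (f x @[x --> s^'-]) = ereal_sup [set f x | x in [set x | 0 <= x < s]].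
Proof.
move=> s0 f_nd; apply/cvg_lim => //; apply/cvg_at_leftNP.
have -> : [set f x | x in [set x | 0 <= x < s]] = (f \o -%R) @` [set` `]- s, 0] ].
  apply/seteqP; split=> [_ [x /= /andP[x0 xs] <-]|_ [x /= + <-]].
    by exists (- x); rewrite /= ?opprK// in_itv/= ltrN2 xs oppr_le0.
  by rewrite in_itv/= => /andP[sx x0]; exists (- x) => //=; rewrite oppr_ge0 x0 ltrNl.
apply: nonincreasing_at_right_cvge; first by rewrite bnd_simp oppr_lt0.
move=> x y; rewrite !in_itv/= => /andP[_ x0] /andP[_ y0] xy.
by apply: f_nd; rewrite ?oppr_ge0// lerN2.
Qed.

Lemma nondecreasing_lim_pinfty f :
  (forall a b, 0 <= a -> a <= b -> (f a <= f b)%E) ->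
  lim (f x @[x --> +oo]) = ereal_sup [set f x | x in [set x | 0 <= x]].
Proof.
move=> f_nd; apply/cvg_lim => //.
have -> : [set f x | x in [set x | 0 <= x]] = range (fun x => f (Num.max 0 x)).
  apply/seteqP; split=> [_ [x /= x0 <-]|_ [x _ <-]].
    by exists x => //; rewrite max_r.
  by exists (Num.max 0 x) => //=; rewrite le_max lexx.
apply: cvg_trans (nondecreasing_cvge _).
  apply: near_eq_cvg; apply: filterS (nbhs_pinfty_ge (num_real 0)) => x x0.
  by rewrite max_r.
move=> x y xy; apply: f_nd; first by rewrite le_max lexx.
by rewrite ge_max !le_max lexx/= xy orbT.
Qed.

End half_line_limits.

Section rationals.
Variable R : realType.

(** A dense set of times enumerated by [nat], so that suprema and infima over it are measurable
    functionals; codes of no pair give the time 0. *)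
Definition nnrat (k : nat) : R :=
  if unpickle k is Some (m, n) then m%:R / n.+1%:R else 0.

Lemma nnrat_ge0 k : 0 <= nnrat k.
Proof. by rewrite /nnrat; case: unpickle => [[m n]|]//; rewrite divr_ge0. Qed.

Lemma nnrat_div m n : exists k, nnrat k = m%:R / n.+1%:R.
Proof. by exists (pickle (m, n)); rewrite /nnrat pickleK. Qed.

Lemma nnrat_dense (a b : R) : 0 <= a -> a < b -> exists k, a < nnrat k < b.
Proof.
move=> a0 ab.
have [n /= nba] : exists n : nat, (b - a)^-1 < n.+1%:R.
  exists (Num.truncn (b - a)^-1); exact: truncnS_gt.
have n0 : 0 < n.+1%:R :> R by rewrite ltr0n.
have h : n.+1%:R^-1 < b - a.
  by rewrite -[ltRHS]invrK ltf_pV2// posrE invr_gt0 subr_gt0.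
pose m := (Num.truncn (a * n.+1%:R)).+1.
have [k kE] := nnrat_div m n; exists k; rewrite kE.
rewrite ltr_pdivlMr// truncnS_gt/= ltr_pdivrMr// /m -natr1.
have : (Num.truncn (a * n.+1%:R))%:R <= a * n.+1%:R.
  by have := truncn_itv (mulr_ge0 a0 (ltW n0)) => /andP[].
move: h; rewrite -(ltr_pM2r n0) mulVf ?gt_eqF//; nra.
Qed.

End rationals.

(** * First times of right-stable properties *)

Section hitting.
Variable R : realType.
Implicit Types (Q : R -> Prop) (t s : R).

Lemma at_rightE (P : R -> Prop) t : (\forall s \near t^'+, P s) ->
  exists2 e, 0 < e & forall s, t < s -> s < t + e -> P s.
Proof.
move=> /nbhs_ballP[e /= e0 Pe]; exists e => // s ts se.
by apply: Pe => //; rewrite /ball/= ltr0_norm ?subr_lt0// opprB ltrBlDl.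
Qed.

(** [switch_time w] and [death_time w] are convertible to instances of this definition. *)
Definition hitting_time Q : \bar R := ereal_inf [set t%:E | t in [set t | 0 <= t /\ Q t]].

Definition right_stable Q := forall t, 0 <= t -> \forall s \near t^'+, Q s <-> Q t.

Lemma hitting_time_ge0 Q : (0 <= hitting_time Q)%E.
Proof. by apply: le_ereal_inf_tmp => _ [t [t0 _] <-]; rewrite lee_fin. Qed.

Lemma lt_hitting_time Q t : 0 <= t -> (t%:E < hitting_time Q)%E -> ~ Q t.
Proof.
by move=> t0 + Qt; apply/negP; rewrite -leNgt; apply: ereal_inf_lbound; exists t.
Qed.

(** If Q failed at s it would also fail shortly after s, and the infimum would be at least s + e. *)
Lemma hitting_time_hit Q s : right_stable Q -> hitting_time Q = s%:E -> Q s.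
Proof.
move=> stQ Qs; have s0 : 0 <= s by rewrite -lee_fin -Qs hitting_time_ge0.
apply: contrapT => nQs; have [e e0 eQ] := at_rightE (stQ s s0).
have : ((s + e)%:E <= hitting_time Q)%E.
  apply: le_ereal_inf_tmp => _ [t [t0 Qt] <-]; rewrite lee_fin leNgt; apply/negP => tse.
  have [ts|st|ts] := ltgtP t s.
  - by apply: (@lt_hitting_time Q t) => //; rewrite Qs lte_fin.
  - by have /(_ st tse) [H _] := eQ t; apply/nQs/H.
  - by apply: nQs; rewrite -ts.
by rewrite Qs lee_fin gerDl leNgt e0.
Qed.

Lemma hitting_time_gt0 Q : right_stable Q -> ~ Q 0 -> (0 < hitting_time Q)%E.
Proof.
move=> stQ nQ0; rewrite lt_neqAle hitting_time_ge0 andbT; apply/eqP => /esym.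
by move/(hitting_time_hit stQ).
Qed.

Lemma hitting_time_nnrat Q : right_stable Q -> hitting_time Q =
  ereal_inf (range (fun k => if `[< Q (nnrat R k) >] then (nnrat R k)%:E else +oo%E)).
Proof.
move=> stQ; apply/eqP; rewrite eq_le; apply/andP; split.
  apply: le_ereal_inf_tmp => _ [k _ <-]; case: asboolP => [Qk|_]; last exact: leey.
  by apply: ereal_inf_lbound; exists (nnrat R k) => //; split => //; exact: nnrat_ge0.
apply: le_ereal_inf_tmp => _ [t [t0 Qt] <-].
apply/lee_addgt0Pr => e e0.
have [e' e'0 eQ] := at_rightE (stQ t t0).
have [|k /andP[tk ke]] := @nnrat_dense R t (t + Num.min e e') t0.
  by rewrite ltrDl lt_min e0.
apply: (@le_trans _ _ (nnrat R k)%:E); last first.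
  by rewrite -EFinD lee_fin (le_trans (ltW ke))// lerD2l ge_min lexx.
apply: ereal_inf_lbound; exists k => //; case: asboolP => // -[].
by apply/(eQ _ tk) => //; rewrite (lt_le_trans ke)// lerD2l ge_min lexx orbT.
Qed.

End hitting.

Section path_functionals.
Context (R : realType) (K : nat).
Implicit Types (w : traj R K) (t s : R) (i : 'I_K) (c : option 'I_K).

(** Dead times receive -oo, unlike in [pos], so that they do not contribute to a supremum. *)
Definition alive_pos w t : \bar R := if w t is Some (x, _) then x%:E else -oo%E.

(* On regular paths the next three functionals are xi_{T-}, xi_{sigma-} and
   xi_sigma, sigma being the switching time; as countable suprema and infima they
   are measurable. *)
Definition final_pos w : \bar R := ereal_sup (range (fun k => alive_pos w (nnrat R k))).

Definition pre_switch_pos w : \bar R := ereal_sup (range (fun k =>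
  if ((nnrat R k)%:E < switch_time w)%E then pos w (nnrat R k) else -oo%E)).

Definition switch_pos w : \bar R := ereal_inf (range (fun k =>
  if (switch_time w < (nnrat R k)%:E)%E then pos w (nnrat R k) else +oo%E)).

Lemma chain_None w t : chain w t = None <-> w t = None.
Proof. by rewrite /chain; case: (w t). Qed.

Lemma pos_pinfty w t : pos w t = +oo%E <-> w t = None.
Proof. by rewrite /pos; case: (w t) => [[]|]. Qed.

Lemma switch_stable w : regular_path w ->
  right_stable (fun t => chain w t <> chain w 0).
Proof.
move=> rw t t0; apply: filterS (path_type_rcont rw t0) => s /= sE.
by rewrite sE.
Qed.

Lemma death_stable w : regular_path w -> right_stable (fun t => pos w t = +oo%E).
Proof.
move=> rw t t0; apply: filterS (path_type_rcont rw t0) => s /= sE.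
by rewrite !pos_pinfty -!chain_None sE.
Qed.

Lemma switch_gt0 w : regular_path w -> (0 < switch_time w)%E.
Proof. by move=> rw; apply: hitting_time_gt0; [exact: switch_stable|apply]. Qed.

Lemma alive_nnrat w s x j : regular_path w -> 0 <= s -> w s = Some (x, j) ->
  exists2 e, 0 < e & forall t, s < t -> t < s + e ->
    exists2 y, w t = Some (y, j) & x <= y.
Proof.
move=> rw s0 ws; have [e e0 eP] := at_rightE (path_type_rcont rw s0).
exists e => // t st te; have := eP t st te.
have := path_nondecreasing rw s0 (ltW st).
rewrite /pos /chain ws /=; case: (w t) => [[y j']|//].
by rewrite lee_fin => xy [->]; exists y.
Qed.

Lemma final_pos_ge w s x j : regular_path w -> 0 <= s -> w s = Some (x, j) ->
  (x%:E <= final_pos w)%E.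
Proof.
move=> rw s0 ws; have [e e0 eP] := alive_nnrat rw s0 ws.
have [|k /andP[sk ke]] := @nnrat_dense R s (s + e) s0; first by rewrite ltrDl.
have [y wy xy] := eP _ sk ke.
apply: (@le_trans _ _ y%:E); first by rewrite lee_fin.
by apply: ereal_sup_ubound; exists k => //; rewrite /alive_pos wy.
Qed.

Lemma final_pos_le w (b : \bar R) :
  (forall s x j, 0 <= s -> w s = Some (x, j) -> (x%:E <= b)%E) -> (final_pos w <= b)%E.
Proof.
move=> wb; apply: ge_ereal_sup => _ [k _ <-]; rewrite /alive_pos.
by case wk: (w _) => [[x j]|]; [apply: wb wk; exact: nnrat_ge0|exact: leNye].
Qed.

(** By monotonicity, the left limit at a finite death time and the limit at +oo of an immortal path
    are both the supremum of the positions at living times. *)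
Lemma pos_before_deathE w : regular_path w -> pos_before_death w = final_pos w.
Proof.
move=> rw.
have d0 : (0 < death_time w)%E.
  apply: hitting_time_gt0; first exact: death_stable.
  by move=> /pos_pinfty; exact: (path_start rw).
have nd := path_nondecreasing rw.
rewrite /pos_before_death; case dE : (death_time w) => [r| |]; last by move: d0; rewrite dE.
- have r0 : 0 < r by rewrite -lte_fin -dE.
  rewrite /pos_left nondecreasing_lim_at_left//.
  have wr : w r = None.
    by apply/pos_pinfty; apply: (hitting_time_hit (death_stable rw)).
  apply/eqP; rewrite eq_le; apply/andP; split.
    apply: ge_ereal_sup => _ [u /= /andP[u0 ur] <-].
    have : ~ pos w u = +oo%E.
      apply: (@lt_hitting_time _ (fun t => pos w t = +oo%E)) => //.
      by rewrite [X in (_ < X)%E]dE lte_fin.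
    rewrite /pos; case wu : (w u) => [[x j]|] // _; exact: final_pos_ge wu.
  apply: final_pos_le => s x j s0 ws; apply: ereal_sup_ubound; exists s; last by rewrite /pos ws.
  rewrite /= s0 ltNge; apply/negP => rs.
  by have := path_absorb rw (ltW r0) rs wr; rewrite ws.
- rewrite nondecreasing_lim_pinfty//.
  apply/eqP; rewrite eq_le; apply/andP; split.
    apply: ge_ereal_sup => _ [u /= u0 <-].
    have : ~ pos w u = +oo%E.
      apply: (@lt_hitting_time _ (fun t => pos w t = +oo%E)) => //.
      by rewrite [X in (_ < X)%E]dE ltry.
    rewrite /pos; case wu : (w u) => [[x j]|] // _; exact: final_pos_ge wu.
  by apply: final_pos_le => s x j s0 ws; apply: ereal_sup_ubound; exists s => //; rewrite /pos ws.
Qed.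

(** The two suprema run over different times, q and t + q with q rational. For the upper bound, a
    living time s is replaced by max(s, t), still alive, and then by some t + q just after it. *)
Lemma final_pos_shift w t x j : regular_path w -> 0 <= t -> w t = Some (x, j) ->
  final_pos w = (x%:E + final_pos (Defs.shift t w))%E.
Proof.
move=> rw t0 wt; apply/eqP; rewrite eq_le; apply/andP; split.
  apply: final_pos_le => s y k s0 ws.
  have [y' [k' [ws' yy']]] : exists y' k', w (Num.max s t) = Some (y', k') /\ y <= y'.
    have [ts|st] := leP t s; first by exists y, k.
    exists x, j; split => //.
    by have := path_nondecreasing rw s0 (ltW st); rewrite /pos ws wt lee_fin.
  have m0 : 0 <= Num.max s t by rewrite le_max s0.
  have [e e0 eP] := alive_nnrat rw m0 ws'.
  have mt : 0 <= Num.max s t - t by rewrite subr_ge0 le_max lexx orbT.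
  have [|q /andP[mq qe]] := @nnrat_dense R _ (Num.max s t - t + e) mt; first by rewrite ltrDl.
  have [||z wz y'z] := eP (t + nnrat R q); [by rewrite -ltrBlDl|by rewrite -ltrBrDl addrAC|].
  apply: (@le_trans _ _ (x%:E + (z - x)%:E)%E).
    by rewrite -EFinD lee_fin addrC subrK (le_trans yy').
  by rewrite leeD2l//; apply: ereal_sup_ubound; exists q => //; rewrite /alive_pos /Defs.shift wt wz.
rewrite addeC -leeBrDr//; apply: ge_ereal_sup => _ [q _ <-].
rewrite /alive_pos /Defs.shift wt; case wq : (w _) => [[z k]|]; last exact: leNye.
rewrite EFinB leeB//; apply: final_pos_ge wq => //.
by rewrite addr_ge0// nnrat_ge0.
Qed.

Lemma final_pos_shift_ge0 w t x j : w t = Some (x, j) -> (0 <= final_pos (Defs.shift t w))%E.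
Proof.
move=> wt; have [q q0] := nnrat_div R 0 0.
apply: ereal_sup_ubound; exists q => //.
by rewrite /alive_pos /Defs.shift q0 mul0r addr0 wt subrr.
Qed.

Section at_switch.
Variables (w : traj R K) (s : R).
Hypotheses (rw : regular_path w) (ws : switch_time w = s%:E).

Let s0 : 0 < s. Proof. by rewrite -lte_fin -ws switch_gt0. Qed.

Lemma chain_before_switch u : 0 <= u -> u < s -> chain w u = chain w 0.
Proof.
move=> u0 us; apply: contrapT; apply: (@lt_hitting_time _ (fun t => chain w t <> chain w 0)) => //.
by rewrite [X in (_ < X)%E]ws lte_fin.
Qed.

Lemma pos_left_switch : pos_left w s = pre_switch_pos w.
Proof.
rewrite /pos_left nondecreasing_lim_at_left//; last exact: path_nondecreasing.
apply/eqP; rewrite eq_le; apply/andP; split; apply: ge_ereal_sup.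
  move=> _ [u /= /andP[u0 us] <-].
  have [q /andP[uq qs]] := nnrat_dense u0 us.
  apply: le_trans (path_nondecreasing rw u0 (ltW uq)) _.
  by apply: ereal_sup_ubound; exists q => //; rewrite ws lte_fin qs.
move=> _ [q _ <-]; rewrite ws lte_fin; case: ifPn => [qs|_]; last exact: leNye.
by apply: ereal_sup_ubound; exists (nnrat R q) => //=; rewrite nnrat_ge0.
Qed.

Lemma pos_switch : pos w s = switch_pos w.
Proof.
apply/eqP; rewrite eq_le; apply/andP; split.
  apply: le_ereal_inf_tmp => _ [q _ <-]; rewrite ws lte_fin; case: ifPn => [sq|_]; last exact: leey.
  by apply: path_nondecreasing => //; exact: ltW.
apply: (cvge_to_ge (path_pos_rcont rw (ltW s0))); near=> t.
have st : s < t by near: t; exact: nbhs_right_gt.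
have [q /andP[sq qt]] := nnrat_dense (ltW s0) st.
apply: (@le_trans _ _ (pos w (nnrat R q))).
  by apply: ereal_inf_lbound; exists q => //; rewrite ws lte_fin sq.
by apply: path_nondecreasing => //; [exact: nnrat_ge0|exact: ltW].
Unshelve. all: by end_near. Qed.

(** Before s the chain keeps its initial living type, so that s is also the death time. *)
Lemma final_pos_killed : w s = None -> final_pos w = pos_left w s.
Proof.
move=> wsN; rewrite -pos_before_deathE// /pos_before_death.
suff -> : death_time w = s%:E by [].
apply/eqP; rewrite eq_le; apply/andP; split.
  by apply: ereal_inf_lbound; exists s => //; split; [exact: ltW|exact/pos_pinfty].
apply: le_ereal_inf_tmp => _ [t [t0 /pos_pinfty wt] <-].
rewrite lee_fin leNgt; apply/negP => /(chain_before_switch t0).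
by rewrite (chain_None w t).2// => /esym/chain_None; exact: (path_start rw).
Qed.

End at_switch.

(* First exit from i observed on the grid of mesh 1 / (n + 1). *)
Definition grid_exit i n k c : set (traj R K) :=
  [set w | (forall l, (l < k)%N -> chain w (l%:R / n.+1%:R) = Some i) /\
           chain w (k%:R / n.+1%:R) = c].

Lemma grid_exit_inj i n k c k' c' w : c <> Some i -> c' <> Some i ->
  grid_exit i n k c w -> grid_exit i n k' c' w -> k = k' /\ c = c'.
Proof.
move=> ci c'i [wi wc] [wi' wc']; have kk' : k = k'.
  have [kk'|k'k|//] := ltngtP k k'.
    by have := wi' _ kk'; rewrite wc.
  by have := wi _ k'k; rewrite wc'.
by split => //; rewrite -wc -wc' kk'.
Qed.

(** k is the index of the first grid point at or after s. Once the mesh is smaller than e1, the time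
    during which the new type lasts, no second switch can precede that point. *)
Lemma grid_exit_switch w s i : regular_path w -> switch_time w = s%:E ->
  chain w 0 = Some i -> forall e, 0 < e -> \forall n \near \oo,
    exists k, grid_exit i n k (chain w s) w /\ s <= k%:R / n.+1%:R < s + e.
Proof.
move=> rw ws wi e e0.
have s0 : 0 < s by rewrite -lte_fin -ws switch_gt0.
have [e1 e10 e1P] := at_rightE (path_type_rcont rw (ltW s0)).
pose N := Num.truncn (Num.min e e1)^-1.
exists N => // n /= Nn.
have n0 : 0 < n.+1%:R :> R by rewrite ltr0n.
have nmin : n.+1%:R^-1 < Num.min e e1.
  rewrite -[ltRHS]invrK ltf_pV2// ?posrE ?invr_gt0 ?lt_min ?e0//.
  by rewrite (lt_le_trans (truncnS_gt _))// ler_nat ltnS.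
have sn0 : 0 <= s * n.+1%:R by rewrite mulr_ge0// ltW.
have exk : exists k : nat, s <= k%:R / n.+1%:R.
  exists (Num.truncn (s * n.+1%:R)).+1; rewrite ler_pdivlMr// ltW//; exact: truncnS_gt.
pose k := ex_minn exk.
have [sk kmin] : s <= k%:R / n.+1%:R /\ forall l, s <= l%:R / n.+1%:R -> (k <= l)%N.
  by rewrite /k; case: ex_minnP.
have before l : (l < k)%N -> l%:R / n.+1%:R < s.
  by move=> lk; rewrite ltNge; apply/negP => /kmin; rewrite leqNgt lk.
have kpos : (0 < k)%N.
  rewrite lt0n; apply/eqP => k0; move: sk; rewrite k0 mul0r.
  by rewrite leNgt s0.
have ke : k%:R / n.+1%:R < s + Num.min e e1.
  have := before k.-1; rewrite ltn_predL kpos => /(_ isT) h.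
  rewrite -(prednK kpos) -natr1 mulrDl mul1r.
  by rewrite ltrD// (lt_le_trans h)// .
exists k; split; last first.
  by rewrite sk (lt_le_trans ke)// lerD2l ge_min lexx.
split=> [l /before ls|].
  by rewrite (chain_before_switch ws)// divr_ge0.
move: sk; rewrite le_eqVlt => /predU1P[<-//|sk].
by apply: e1P => //; rewrite (lt_le_trans ke)// lerD2l ge_min lexx orbT.
Qed.

End path_functionals.

(** * Measurability on the space of paths *)

Section path_measurability.
Context (R : realType) (K : nat).
Implicit Types (I : set R) (w : traj R K) (t : R) (j : 'I_K) (c : option 'I_K).

Definition coordinate_events I : set (set (traj R K)) :=
  [set E | exists t j (A : set (measurableTypeR R)),
    [/\ I t, measurable A &
        E = [set w : traj R K | exists2 x, w t = Some (x, j) & A x]]].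

(** [measurable] on this type is convertible to [cylinder_events I], so the events required by
    [MAP_markov] are obtained by the usual measurability rules. *)
Definition path_space I := g_sigma_algebraType (coordinate_events I).

(** The generating events only describe living states; the state [None] is reached as the complement
    of a finite union over types. *)
Lemma measurable_fun_coord d' (T' : measurableType d') I t (F : option (R * 'I_K) -> T') :
  I t -> (forall j, measurable_fun setT (fun x : measurableTypeR R => F (Some (x, j)))) ->
  measurable_fun setT (fun w : path_space I => F (w t)).
Proof.
move=> It mF _ B mB; rewrite setTI.
pose E j (A : set (measurableTypeR R)) := [set w : traj R K | exists2 x, w t = Some (x, j) & A x].
have mE j A : measurable A -> measurable (E j A : set (path_space I)).
  by move=> mA; apply: sub_sigma_algebra; exists t, j, A.
have mEF : measurable ((\bigcup_(j in setT) E j (fun x => B (F (Some (x, j))))) : set (path_space I)).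
  apply: fin_bigcup_measurable; first exact: finite_finset.
  move=> j _; apply: mE.
  by rewrite -[X in measurable X]setTI; exact: mF.
have mEN : measurable ((~` \bigcup_(j in setT) E j setT) : set (path_space I)).
  apply: measurableC; apply: fin_bigcup_measurable; first exact: finite_finset.
  by move=> j _; apply: mE.
have EN w : (~` \bigcup_(j in setT) E j setT) w <-> w t = None.
  split=> [NE|wN]; last by case=> j _ [x]; rewrite wN.
  by case wt : (w t) => [[x j]|//]; exfalso; apply: NE; exists j => //; exists x.
have [BN|BN] := pselect (B (F None)).
  rewrite (_ : _ @^-1` B = (\bigcup_(j in setT) E j (fun x => B (F (Some (x, j))))) `|`
      (~` \bigcup_(j in setT) E j setT)); first exact: measurableU.
  apply/seteqP; split=> w /=.
    case wt : (w t) => [[x j]|] Bw; last by right; apply/EN.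
    by left; exists j => //; exists x.
  by move=> [[j _ [x -> //]]|/EN ->].
rewrite (_ : _ @^-1` B = \bigcup_(j in setT) E j (fun x => B (F (Some (x, j)))))//.
apply/seteqP; split=> w /=; last by move=> [j _ [x ->]].
by case wt : (w t) => [[x j]|//] Bw; exists j => //; exists x.
Qed.

Lemma measurable_chain I t c : I t ->
  measurable ([set w | chain w t = c] : set (path_space I)).
Proof.
move=> It.
have := @measurable_fun_coord _ bool I t (fun v => omap snd v == c) It.
move=> /(_ _ measurableT [set true]); rewrite setTI => H.
rewrite (_ : [set w | _] = (fun w => omap snd (w t) == c) @^-1` [set true]).
  by apply: H => // j; exact: (measurable_cst (Some j == c)).
by apply/seteqP; split=> w /=; rewrite /chain => /eqP.
Qed.

Lemma measurable_pos I t : I t -> measurable_fun setT (fun w : path_space I => pos w t).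
Proof.
move=> It; apply: (@measurable_fun_coord _ _ I t (fun v => if v is Some (x, _) then x%:E else +oo%E)) => // j.
exact/measurable_EFinP.
Qed.

Lemma measurable_alive_pos I t : I t ->
  measurable_fun setT (fun w : path_space I => alive_pos w t).
Proof.
move=> It; apply: (@measurable_fun_coord _ _ I t (fun v => if v is Some (x, _) then x%:E else -oo%E)) => // j.
exact/measurable_EFinP.
Qed.

Lemma range_esups (u : nat -> \bar R) : ereal_sup (range u) = esups u 0.
Proof. by rewrite /esups /sdrop; congr ereal_sup; apply/seteqP; split=> _ [k _ <-]; exists k. Qed.

Lemma range_einfs (u : nat -> \bar R) : ereal_inf (range u) = einfs u 0.
Proof. by rewrite /einfs /sdrop; congr ereal_inf; apply/seteqP; split=> _ [k _ <-]; exists k. Qed.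

Lemma measurable_fun_range_sup d (T : measurableType d) (u : nat -> T -> \bar R) :
  (forall k, measurable_fun setT (u k)) ->
  measurable_fun setT (fun x => ereal_sup (range (fun k => u k x))).
Proof. by move=> mu; under eq_fun do rewrite range_esups; exact: measurable_fun_esups. Qed.

Lemma measurable_fun_range_inf d (T : measurableType d) (u : nat -> T -> \bar R) :
  (forall k, measurable_fun setT (u k)) ->
  measurable_fun setT (fun x => ereal_inf (range (fun k => u k x))).
Proof. by move=> mu; under eq_fun do rewrite range_einfs; exact: measurable_fun_einfs. Qed.

Lemma measurable_final_pos :
  measurable_fun setT (fun w : path_space `[0, +oo[ => final_pos w).
Proof.
apply: measurable_fun_range_sup => k; apply: measurable_alive_pos.
by rewrite /= in_itv/= andbT nnrat_ge0.
Qed.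

Lemma measurable_final_pos_shift t : 0 <= t ->
  measurable_fun setT (fun w : path_space `[0, +oo[ => final_pos (Defs.shift t w)).
Proof.
move=> t0; apply: measurable_fun_range_sup => k.
have I0 s : 0 <= s -> `[0, +oo[%classic s by move=> ?; rewrite /= in_itv/= andbT.
pose s := t + nnrat R k; have s0 : 0 <= s by rewrite addr_ge0// nnrat_ge0.
(* The increment is written with the coordinates at t and s separately; [fine] is harmless because
   dead states are set aside first. *)
have -> : (fun w : path_space `[0, +oo[ => alive_pos (Defs.shift t w) (nnrat R k)) =
  (fun w => if (chain w t == None) || (chain w s == None) then -oo%E
            else (fine (pos w s) - fine (pos w t))%:E).
  apply/funext => w; rewrite /alive_pos /Defs.shift /chain /pos -/s.
  by case: (w t) => [[x i]|]; case: (w s) => [[y j]|].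
have mb u : 0 <= u -> measurable_fun setT (fun w : path_space `[0, +oo[ => chain w u == None).
  move=> u0; apply: (measurable_fun_bool true); rewrite setTI.
  rewrite (_ : _ @^-1` _ = [set w | chain w u = None]); first by apply: measurable_chain; exact: I0.
  by apply/seteqP; split=> w /= /eqP.
apply: measurable_fun_ifT => //.
  by apply: measurable_or; exact: mb.
have mp u : 0 <= u -> measurable_fun setT (fun w : path_space `[0, +oo[ => fine (pos w u)).
  move=> u0; apply: (@measurableT_comp _ _ _ _ _ _ fine); first exact: fine_measurable.
  by apply: measurable_pos; exact: I0.
by apply/measurable_EFinP; apply: measurable_funB; exact: mp.
Qed.

End path_measurability.

(** * Measurability of the first switch *)

Section MAP_measurability.
Context (R : realType) (K : nat) (d : measure_display) (Om : measurableType d).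
Variables (X : Om -> traj R K) (P : R -> 'I_K -> probability Om R).
Hypothesis X_MAP : nondecreasing_MAP X P.
Implicit Types (c : option 'I_K).

Lemma measurable_X : measurable_fun setT (X : Om -> path_space K `[0, +oo[).
Proof.
apply: (@measurability _ _ Om (path_space K `[0, +oo[) setT X
  (coordinate_events `[0%R, +oo[%classic) erefl).
move=> _ [_ [t [j [A [/= + mA ->]]]] <-]; rewrite in_itv/= andbT setTI => t0.
exact: (MAP_measurable X_MAP).
Qed.

Lemma measurable_cylinder (G : set (traj R K)) :
  cylinder_events `[0, +oo[%classic G -> measurable [set o | G (X o)].
Proof.
move=> mG; rewrite -[X in measurable X]setTI.
exact: (measurable_X measurableT (Y := G)).
Qed.

Lemma measurable_comp_X d' (T' : measurableType d') (f : path_space K `[0, +oo[ -> T') :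
  measurable_fun setT f -> measurable_fun setT (fun o => f (X o)).
Proof. by move=> mf; apply: (measurableT_comp mf); exact: measurable_X. Qed.

Let I0 (t : R) : 0 <= t -> `[0, +oo[%classic t.
Proof. by move=> ?; rewrite /= in_itv/= andbT. Qed.

Lemma measurable_chain_X t c : 0 <= t -> measurable [set o | chain (X o) t = c].
Proof.
move=> t0; apply: (@measurable_cylinder (fun w => chain w t = c)).
by apply: measurable_chain; exact: I0.
Qed.

Lemma measurable_pos_X t : 0 <= t -> measurable_fun setT (fun o => pos (X o) t).
Proof.
move=> t0; apply: (@measurable_comp_X _ _ (fun w => pos w t)).
by apply: measurable_pos; exact: I0.
Qed.

Lemma measurable_switch_time : measurable_fun setT (fun o => switch_time (X o)).
Proof.
have -> : (fun o => switch_time (X o)) = (fun o => ereal_inf (range (fun k =>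
    if `[< chain (X o) (nnrat R k) <> chain (X o) 0 >] then (nnrat R k)%:E else +oo%E))).
  apply/funext => o; exact: (hitting_time_nnrat (switch_stable (MAP_path X_MAP o))).
apply: measurable_fun_range_inf => k.
(* Equality of the two types, unlike their difference, is directly a finite union over the common
   value. *)
have -> : (fun o => if `[< chain (X o) (nnrat R k) <> chain (X o) 0 >] then (nnrat R k)%:E else +oo%E) =
  (fun o => if `[< chain (X o) (nnrat R k) = chain (X o) 0 >] then +oo%E else (nnrat R k)%:E).
  by apply/funext => o; case: asboolP => ?; case: asboolP.
apply: measurable_fun_ifT => //; apply: (measurable_fun_bool true); rewrite setTI.
rewrite (_ : _ @^-1` _ = \bigcup_(c in setT) ([set o | chain (X o) (nnrat R k) = c] `&`
   [set o | chain (X o) 0 = c])).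
  apply: fin_bigcup_measurable => [|c _]; first exact: finite_finset.
  by apply: measurableI; apply: measurable_chain_X => //; exact: nnrat_ge0.
apply/seteqP; split=> o /=; last by move=> [c _ [/= -> ->]]; exact/asboolP.
by move=> /asboolP oE; exists (chain (X o) 0).
Qed.

Lemma measurable_switch_lt (q : R) : measurable [set o | (switch_time (X o) < q%:E)%E].
Proof.
by rewrite -[X in measurable X]setTI; apply: emeasurable_fun_infty_o => //; exact: measurable_switch_time.
Qed.

Lemma measurable_pre_switch_pos : measurable_fun setT (fun o => pre_switch_pos (X o)).
Proof.
apply: measurable_fun_range_sup => k; apply: measurable_fun_ifT => //.
  by apply: measurable_fun_lte => //; exact: measurable_switch_time.
by apply: measurable_pos_X; exact: nnrat_ge0.
Qed.

Lemma measurable_switch_pos : measurable_fun setT (fun o => switch_pos (X o)).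
Proof.
apply: measurable_fun_range_inf => k; apply: measurable_fun_ifT => //.
  by apply: measurable_fun_lte => //; exact: measurable_switch_time.
by apply: measurable_pos_X; exact: nnrat_ge0.
Qed.

Definition switch_to c : set Om :=
  [set o | exists2 s, switch_time (X o) = s%:E & chain (X o) s = c].

(** By right-continuity, the type at sigma is c exactly when, for some rational q_k > sigma, it is c
    at all rationals of ]sigma, q_k[. *)
Lemma measurable_switch_to c : measurable (switch_to c).
Proof.
pose q k := nnrat R k.
rewrite (_ : switch_to c = \bigcup_k ([set o | (switch_time (X o) < (q k)%:E)%E] `&`
  \bigcap_l (~` [set o | (switch_time (X o) < (q l)%:E)%E] `|`
    ([set o | chain (X o) (q l) = c] `|` [set o | q k <= q l])))).
  apply: bigcupT_measurable => k; apply: measurableI; first exact: measurable_switch_lt.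
  apply: bigcapT_measurable => l; apply: measurableU.
    by apply: measurableC; exact: measurable_switch_lt.
  apply: measurableU; first by apply: measurable_chain_X; exact: nnrat_ge0.
  have [kl|kl] := boolP (q k <= q l).
    by rewrite (_ : [set _ | _] = setT)//; apply/seteqP.
  rewrite (_ : [set _ | _] = set0); first exact: measurable0.
  by apply/seteqP; split=> // o /=; apply/negP.
have rX o := MAP_path X_MAP o.
apply/seteqP; split=> o.
  move=> [s so sc].
  have s0 : 0 <= s by rewrite ltW// -lte_fin -so switch_gt0.
  have [e e0 eP] := at_rightE (path_type_rcont (rX o) s0).
  have [|k /andP[sk ke]] := @nnrat_dense R s (s + e) s0; first by rewrite ltrDl.
  exists k => //; split; first by rewrite /= so lte_fin.
  move=> l _; have [lk|kl] := ltP (q l) (q k); last by right; right.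
  have [sl|ls] := ltP s (q l); last by left; rewrite /= so lte_fin; apply/negP; rewrite -leNgt.
  by right; left; rewrite /= -sc; apply: eP => //; exact: lt_trans lk ke.
move=> [k _ [/= ok] oP].
have ofin : switch_time (X o) = (fine (switch_time (X o)))%:E.
  rewrite fineK// ge0_fin_numE; first exact: lt_trans ok (ltry _).
  exact: ltW (switch_gt0 (rX o)).
set s := fine _ in ofin.
have s0 : 0 <= s by rewrite ltW// -lte_fin -ofin switch_gt0.
have sk : s < q k by rewrite -lte_fin -ofin.
exists s => //.
have [e e0 eP] := at_rightE (path_type_rcont (rX o) s0).
have [|l /andP[sl le]] := @nnrat_dense R s (Num.min (q k) (s + e)) s0.
  by rewrite lt_min sk ltrDl.
move: le; rewrite lt_min => /andP[lk le].
rewrite -(eP _ sl le); have [|[//|/=]] := oP l I; first by rewrite /= ofin lte_fin sl.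
by rewrite leNgt lk.
Qed.


(** Finiteness of xi_{sigma-} is included because the events of [MAP_switch] and [MAP_kill] contain
    it; [exits_mass] shows that these exits exhaust the probability. *)
Definition exits c : set Om :=
  switch_to c `&` [set o | pre_switch_pos (X o) \is a fin_num].

Definition pre_pos (o : Om) : measurableTypeR R := fine (pre_switch_pos (X o)).

Definition jump_size (o : Om) : measurableTypeR R := fine (switch_pos (X o)) - pre_pos o.

Lemma measurable_exits c : measurable (exits c).
Proof.
apply: measurableI; first exact: measurable_switch_to.
by rewrite -[X in measurable X]setTI; apply: emeasurable_fin_num => //; exact: measurable_pre_switch_pos.
Qed.

Lemma measurable_pre_pos : measurable_fun setT pre_pos.
Proof.
by apply: (@measurableT_comp _ _ _ _ _ _ fine); [exact: fine_measurable|exact: measurable_pre_switch_pos].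
Qed.

Lemma measurable_jump_size : measurable_fun setT jump_size.
Proof.
apply: measurable_funB; last exact: measurable_pre_pos.
by apply: (@measurableT_comp _ _ _ _ _ _ fine); [exact: fine_measurable|exact: measurable_switch_pos].
Qed.

Lemma exits_uniq c c' o : exits c o -> exits c' o -> c = c'.
Proof. by move=> [[s so <-] _] [[s' so' <-] _]; move: so'; rewrite so => -[->]. Qed.

Lemma exits_pre_pos c o s : exits c o -> switch_time (X o) = s%:E ->
  pos_left (X o) s = (pre_pos o)%:E.
Proof.
by move=> [_ /= fin] so; rewrite (pos_left_switch (MAP_path X_MAP o) so) fineK.
Qed.

Lemma exits_pos c o s y j : exits c o -> switch_time (X o) = s%:E ->
  X o s = Some (y, j) -> y = pre_pos o + jump_size o.
Proof.
move=> _ so oy; rewrite /jump_size addrC subrK.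
by rewrite -(pos_switch (MAP_path X_MAP o) so) /pos oy.
Qed.

(** The time t enters only through sigma <= t, so that it can be sent to +oo in [MAP_kill]. *)
Lemma exits_None_event (t : R) (A : set R) :
  [set o | exists s x, [/\ s <= t, switch_time (X o) = s%:E, X o s = None,
                 pos_left (X o) s = x%:E & A x]] =
  [set o | (switch_time (X o) <= t%:E)%E] `&` (exits None `&` pre_pos @^-1` A).
Proof.
apply/seteqP; split=> o /=.
  move=> [s [x [st so oN ox Ax]]]; rewrite so lee_fin; split=> //.
  have eo : exits None o.
    split; first by exists s => //; exact/chain_None.
    by rewrite /= -(pos_left_switch (MAP_path X_MAP o) so) ox.
  by split=> //; move: ox; rewrite (exits_pre_pos eo so) => -[->].
move=> [st [eo oA]]; have [[s so os] _] := eo; exists s, (pre_pos o).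
by split=> //; [rewrite -lee_fin -so|exact/chain_None|exact: exits_pre_pos eo so].
Qed.

Lemma exits_Some_event (t : R) j (A C : set R) :
  [set o | exists s x y, [/\ s <= t, switch_time (X o) = s%:E, X o s = Some (y, j),
                 pos_left (X o) s = x%:E & A x /\ C (y - x)]] =
  [set o | (switch_time (X o) <= t%:E)%E] `&`
    (exits (Some j) `&` (pre_pos @^-1` A `&` jump_size @^-1` C)).
Proof.
apply/seteqP; split=> o /=.
  move=> [s [x [y [st so oy ox [Ax Cxy]]]]]; rewrite so lee_fin; split=> //.
  have eo : exits (Some j) o.
    split; first by exists s => //; rewrite /chain oy.
    by rewrite /= -(pos_left_switch (MAP_path X_MAP o) so) ox.
  have xE : x = pre_pos o by move: ox; rewrite (exits_pre_pos eo so) => -[->].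
  split=> //; split; first by rewrite -xE.
  by have := exits_pos eo so oy; rewrite -xE => yE; move: Cxy; rewrite yE addrAC subrr add0r.
move=> [st [eo [oA oC]]]; have [[s so os] _] := eo.
move: os; rewrite /chain; case oy : (X o s) => [[y k]|//] /= [kj]; subst k.
exists s, (pre_pos o), y; split=> //.
- by rewrite -lee_fin -so.
- exact: exits_pre_pos eo so.
- by split=> //; rewrite (exits_pos eo so oy) addrAC subrr add0r.
Qed.

(** Both sides are continuous along increasing sets, t running through the integers. The factor b is
    1 for a killing and the mass of C for a jump. *)
Lemma switch_limit (m : {finite_measure set Om -> \bar R}) (E : set Om)
    (G : measurableTypeR R -> \bar R) (b : R) :
  measurable E -> (forall o, E o -> (switch_time (X o) < +oo)%E) ->
  (forall s : R, 0 <= s -> (0 <= G s)%E) ->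
  measurable_fun (`[0%R, +oo[%classic : set (measurableTypeR R)) G ->
  (forall n : nat, m ([set o | (switch_time (X o) <= n%:R%:E)%E] `&` E) =
    ((\int[lebesgue_measure]_(s in `[0%R, n%:R]) G s) * b%:E)%E) ->
  m E = ((\int[lebesgue_measure]_(s in `[0%R, +oo[) G s) * b%:E)%E.
Proof.
move=> mE Efin G0 mG mEn.
pose F n := [set o | (switch_time (X o) <= n%:R%:E)%E] `&` E.
have EF : E = \bigcup_n F n.
  apply/seteqP; split; last by move=> o [n _ []].
  move=> o Eo.
  exists (Num.truncn (fine (switch_time (X o)))).+1 => //; split=> //=.
  rewrite -[leLHS]fineK.
    by rewrite lee_fin ltW//; exact: truncnS_gt.
  by rewrite ge0_fin_numE ?Efin// ltW// switch_gt0//; exact: (MAP_path X_MAP).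
have mF n : measurable (F n).
  apply: measurableI => //.
  by rewrite -[X in measurable X]setTI; apply: emeasurable_fun_infty_c => //; exact: measurable_switch_time.
have cvgF : m (F n) @[n --> \oo] --> m E.
  rewrite [in X in _ --> X]EF; apply: nondecreasing_cvg_mu => //; first by rewrite -EF.
  move=> n k nk; apply/subsetPset => o [/= on Eo]; split=> //=.
  by rewrite (le_trans on)// lee_fin ler_nat.
pose I n : set (measurableTypeR R) := `[0%R, n%:R]%classic.
have UI : \bigcup_n I n = `[0, +oo[%classic.
  apply/seteqP; split=> [s [n _]|s]; rewrite /I /= !in_itv/= ?andbT; first by case/andP.
  move=> s0; exists (Num.truncn s).+1 => //=; rewrite in_itv/= s0 ltW//; exact: truncnS_gt.
have cvgI : (\int[lebesgue_measure]_(s in I n) G s)%E @[n --> \oo] -->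
    (\int[lebesgue_measure]_(s in `[0%R, +oo[) G s)%E.
  rewrite -UI; apply: ge0_nondecreasing_set_cvg_integral.
  - move=> n k nk; apply/subsetPset => s; rewrite /I /= !in_itv/= => /andP[-> sn].
    by rewrite (le_trans sn)// ler_nat.
  - by move=> n; exact: measurable_itv.
  - move=> n; apply: measurable_funS mG; first exact: measurable_itv.
    by rewrite -UI; exact: bigcup_sup.
  - by move=> n s; rewrite /I /= in_itv/= => /andP[s0 _]; exact: G0.
have cvgF' : m (F n) @[n --> \oo] --> ((\int[lebesgue_measure]_(s in `[0%R, +oo[) G s) * b%:E)%E.
  by under eq_fun do rewrite mEn; exact: cvgeZr.
by rewrite -(cvg_lim _ cvgF)// (cvg_lim _ cvgF').
Qed.

End MAP_measurability.

(** * The laws at the first switch *)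

Lemma big_option (T : finType) (V : nmodType) (Q : pred (option T)) (F : option T -> V) : Q None ->
  \sum_(c | Q c) F c = F None + \sum_(j | Q (Some j)) F (Some j).
Proof.
move=> QN; rewrite (bigD1 None)//=; congr (_ + _).
rewrite (reindex_omap Some id) => [|[c|]]//=; last by rewrite andbF.
by apply: eq_bigl => j; rewrite eqxx !andbT.
Qed.

Lemma integral_expR_half_line (R : realType) (r : R) : 0 < r ->
  (\int[lebesgue_measure]_(s in `[0%R, +oo[) (expR (- (r * s)))%:E = (r^-1)%:E)%E.
Proof.
move=> r0.
have H : (\int[lebesgue_measure]_(s in `[0%R, +oo[) (r * expR (- (r * s)))%:E = 1)%E.
  rewrite integral_mkcond -(integral_exponential_pdf r0); apply: eq_integral => s _.
  by rewrite /exponential_pdf /patch -mulNr; case: ifP.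
rewrite (eq_integral (fun s : measurableTypeR R => (r^-1)%:E * (r * expR (- (r * s)))%:E)%E); last first.
  by move=> s _; rewrite -EFinM mulKf ?gt_eqF.
rewrite ge0_integralZl_EFin//.
- by rewrite H mule1.
- by move=> s _; rewrite lee_fin mulr_ge0 ?expR_ge0// ltW.
- by apply/measurable_EFinP; apply: measurable_funM => //; exact: measurable_expRM.
- by rewrite invr_ge0 ltW.
Qed.

Lemma integral_supported_ge0 (R : realType) (m : {measure set (measurableTypeR R) -> \bar R})
    (f : measurableTypeR R -> \bar R) : m `]-oo, 0[%classic = 0%E ->
  (forall x, (0 <= f x)%E) -> measurable_fun setT f ->
  (\int[m]_x f x = \int[m]_(x in `[0%R, +oo[) f x)%E.
Proof.
move=> m0 f0 mf; rewrite (@ge0_negligible_integral _ _ _ _ setT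
  (`]-oo, 0[%classic : set (measurableTypeR R)))//.
by congr (integral _ _ _); rewrite setTD setCitvl.
Qed.

Section exit_laws.
Context (R : realType) (K : nat) (d : measure_display) (Om : measurableType d).
Variables (X : Om -> traj R K) (P : R -> 'I_K -> probability Om R).
Hypothesis X_MAP : nondecreasing_MAP X P.
Variables (ch : characteristics R K) (i : 'I_K)
  (mu : R.-spker (measurableTypeR R) ~> (measurableTypeR R)).
Hypothesis X_ch : has_characteristics_from X P ch i mu.
Local Notation leb := lebesgue_measure.
Local Notation e q := (fun x : measurableTypeR R => (expR (- (q * x)))%:E).

Let mk A : measurable A -> measurable_fun setT (mu ^~ A).
Proof. exact: measurable_kernel. Qed.

Let e0 q x : (0 <= e q x)%E. Proof. by rewrite lee_fin expR_ge0. Qed.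

Let me q : measurable_fun setT (e q).
Proof. by apply/measurable_EFinP; exact: measurable_expRM. Qed.

Let fin_switch c o : exits X c o -> (switch_time (X o) < +oo)%E.
Proof. by move=> [[s -> _] _]; exact: ltry. Qed.

Let mw (b : R) : measurable_fun setT (fun s : measurableTypeR R => b * expR (rate ch i i * s)).
Proof. by apply: measurable_funM => //; apply: measurableT_comp => //; exact: measurable_funM. Qed.

Lemma exits_None_law (A : set (measurableTypeR R)) : measurable A ->
  (P 0 i (exits X None `&` (pre_pos X @^-1` A)) =
  \int[leb]_(s in `[0%R, +oo[) ((kill ch i * expR (rate ch i i * s))%:E * mu s A))%E.
Proof.
move=> mA; rewrite (@switch_limit _ _ _ _ _ _ X_MAP (P 0 i) _
  (fun s => (kill ch i * expR (rate ch i i * s))%:E * mu s A)%E 1) ?mule1//.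
- apply: measurableI; first exact: (measurable_exits X_MAP).
  by rewrite -[X in measurable X]setTI; exact: (measurable_pre_pos X_MAP measurableT mA).
- by move=> o [/fin_switch].
- by move=> s s0; rewrite mule_ge0// lee_fin mulr_ge0 ?kill_ge0 ?expR_ge0.
- apply: measurable_funTS; apply: emeasurable_funM; last exact: mk.
  exact/measurable_EFinP.
by move=> n; rewrite mule1 -(exits_None_event X_MAP)//; exact: (MAP_kill X_ch (ler0n R n) mA).
Qed.

Lemma exits_Some_law j (A C : set (measurableTypeR R)) : j != i -> measurable A -> measurable C ->
  (P 0 i (exits X (Some j) `&` (pre_pos X @^-1` A `&` jump_size X @^-1` C)) =
  (\int[leb]_(s in `[0%R, +oo[) ((rate ch i j * expR (rate ch i i * s))%:E * mu s A)) *
  jump ch i j C)%E.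
Proof.
move=> ji mA mC.
have jC : jump ch i j C = (fine (jump ch i j C))%:E by rewrite fineK// fin_num_measure.
rewrite jC; apply: (@switch_limit _ _ _ _ _ _ X_MAP (P 0 i)).
- apply: measurableI; first exact: (measurable_exits X_MAP).
  apply: measurableI; rewrite -[X in measurable X]setTI.
    exact: (measurable_pre_pos X_MAP measurableT mA).
  exact: (measurable_jump_size X_MAP measurableT mC).
- by move=> o [/fin_switch].
- by move=> s s0; rewrite mule_ge0// lee_fin mulr_ge0 ?rate_ge0 ?expR_ge0// eq_sym.
- apply: measurable_funTS; apply: emeasurable_funM; last exact: mk.
  exact/measurable_EFinP.
by move=> n; rewrite -jC -(exits_Some_event X_MAP)//; exact: (MAP_switch X_ch (ler0n R n) ji mA mC).
Qed.

Section laplace.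
Variable q : R.
Hypothesis mu_q : forall t, 0 <= t ->
  (\int[mu t]_(x in `[0%R, +oo[) (expR (- (q * x)))%:E =
   (expR (- (t * laplace_exponent ch i q)))%:E)%E.
Let r := laplace_exponent ch i q - rate ch i i.
Hypothesis r0 : 0 < r.

(** Clock and subordinator combine into e^{lambda_{i,i} s} e^{- s psi_i(q)} = e^{- r s}, whose
    integral over time is 1 / r. *)
Lemma discounted_laplace (b : R) : 0 <= b ->
  (\int[leb]_(s in `[0%R, +oo[) ((b * expR (rate ch i i * s))%:E * \int[mu s]_x e q x) =
   (b / r)%:E)%E.
Proof.
move=> b0.
rewrite (eq_integral (fun s : measurableTypeR R => b%:E * (expR (- (r * s)))%:E)%E); last first.
  move=> s; rewrite inE/= in_itv/= andbT => s0.
  have [ms0 _] := MAP_subordinator X_ch s0.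
  rewrite integral_supported_ge0// mu_q// -!EFinM -mulrA -expRD; congr (_ * expR _)%:E.
  by rewrite /r; ring.
rewrite ge0_integralZl_EFin//.
- by rewrite integral_expR_half_line// -EFinM.
- by apply/measurable_EFinP; exact: measurable_expRM.
Qed.

Lemma exits_None_laplace :
  (\int[P 0 i]_(o in exits X None) (expR (- (q * pre_pos X o)))%:E = (kill ch i / r)%:E)%E.
Proof.
have [m [mE mI]] := law_restr (P 0 i) (measurable_exits X_MAP None) (measurable_pre_pos X_MAP).
rewrite (mI (e q))// -discounted_laplace ?kill_ge0//.
apply: integral_mixture => //.
- exact: measurable_funTS.
- by move=> s _; rewrite mulr_ge0 ?kill_ge0 ?expR_ge0.
- by move=> A mA; exact: etrans (mE _ mA) (exits_None_law mA).
Qed.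

Lemma exits_Some_laplace j : j != i ->
  (\int[P 0 i]_(o in exits X (Some j)) (expR (- (q * (pre_pos X o + jump_size X o))))%:E =
  (rate ch i j / r)%:E * \int[jump ch i j]_(x in `[0%R, +oo[) (expR (- (q * x)))%:E)%E.
Proof.
move=> ji.
have r_ij : 0 <= rate ch i j by rewrite rate_ge0// eq_sym.
have [m [mE mI]] := law_restr (P 0 i) (measurable_exits X_MAP (Some j)) (measurable_pre_pos X_MAP).
have mA_law A : measurable A -> m A =
    (\int[leb]_(s in `[0%R, +oo[) ((rate ch i j * expR (rate ch i i * s))%:E * mu s A))%E.
  move=> mA; apply: etrans (mE _ mA) _.
  (* Taking the whole line for C isolates the law of xi_{sigma-}, the jump law having mass 1. *)
  have := exits_Some_law ji mA (@measurableT _ (measurableTypeR R)).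
  by rewrite preimage_setT setIT probability_setT mule1.
under eq_integral do rewrite mulrDr opprD expRD EFinM.
rewrite (@integral_indep _ _ _ _ _ _ _ (measurableTypeR R) R (P 0 i) (jump ch i j) _
  (pre_pos X) (jump_size X) id (e q) (e q))//; last 4 first.
- exact: (measurable_exits X_MAP).
- exact: (measurable_pre_pos X_MAP).
- exact: (measurable_jump_size X_MAP).
- by move=> A C mA mC; apply: etrans (exits_Some_law ji mA mC) _; rewrite -mA_law// mE.
congr (_ * _)%E.
- rewrite (mI (e q))// -discounted_laplace//.
  apply: integral_mixture => //; first exact: measurable_funTS.
  by move=> s _; rewrite mulr_ge0// expR_ge0.
- rewrite integral_supported_ge0//.
  have := probability_setC (jump ch i j) (measurable_itv `[0, +oo[).
  by rewrite (jump_ge0 ch) subee// setCitvr.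
Qed.

End laplace.

Lemma laplace_exponent0 : laplace_exponent ch i 0 = kill ch i.
Proof.
rewrite /laplace_exponent mulr0 addr0 /Rintegral integral0_eq ?addr0// => x _.
by rewrite mul0r oppr0 expR0 subrr.
Qed.

Hypothesis r0 : 0 < kill ch i - rate ch i i.

(** At q = 0 the Laplace transforms of the exits are their probabilities k^(i) / r and lambda_{i,j}
    / r, which add up to 1 because the rows of [rate] sum to 0. *)
Lemma exits_mass : (\sum_(c | c != Some i) P 0 i (exits X c) = 1)%E.
Proof.
have mass c : P 0 i (exits X c) = (\int[P 0 i]_(o in exits X c) (expR (- (0 * 0)))%:E)%E.
  by rewrite integral_cst ?mul0r ?oppr0 ?expR0 ?mul1e//; exact: (measurable_exits X_MAP).
have mu_0 t : 0 <= t -> (\int[mu t]_(x in `[0%R, +oo[) (expR (- (0 * x)))%:E =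
    (expR (- (t * laplace_exponent ch i 0)))%:E)%E.
  by move=> t0; have [_ ->] := MAP_subordinator X_ch t0.
have r0' : 0 < laplace_exponent ch i 0 - rate ch i i by rewrite laplace_exponent0.
have massN : P 0 i (exits X None) = (kill ch i / (kill ch i - rate ch i i))%:E.
  rewrite mass; have := exits_None_laplace mu_0 r0'; rewrite laplace_exponent0 => <-.
  by apply: eq_integral => o _; rewrite !mul0r.
have massS j : j != i -> P 0 i (exits X (Some j)) =
    (rate ch i j / (kill ch i - rate ch i i))%:E.
  move=> ji; rewrite mass.
  have := exits_Some_laplace mu_0 r0' ji; rewrite laplace_exponent0.
  rewrite [X in (_ * X)%E](_ : _ = 1%E) ?mule1 => [<-|].
    by apply: eq_integral => o _; rewrite !mul0r.
  rewrite (eq_integral (fun=> 1%E)) => [|x _]; last by rewrite mul0r oppr0 expR0.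
  by rewrite integral_cst//= mul1e (jump_ge0 ch).
rewrite big_option// massN (eq_bigr (fun j => (rate ch i j / (kill ch i - rate ch i i))%:E)); last first.
  by move=> j; rewrite (inj_eq Some_inj); exact: massS.
rewrite sumEFin -EFinD -mulr_suml -mulrDl.
have := rate_sum0 ch i; rewrite (bigD1 i)//= => /eqP; rewrite addrC addr_eq0 => /eqP.
under eq_bigl do rewrite -(inj_eq Some_inj).
by move=> ->; rewrite divff// gt_eqF.
Qed.

Let s := [seq c <- enum {: option 'I_K} | c != Some i].
Let A := \big[setU/set0]_(c <- s) exits X c.

Let mE c : measurable (exits X c). Proof. exact: (measurable_exits X_MAP). Qed.

Let mA : measurable A. Proof. exact: bigsetU_measurable. Qed.

Let intA (h : Om -> \bar R) : (forall o, (0 <= h o)%E) -> measurable_fun setT h ->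
  (\int[P 0 i]_(o in A) h o = \sum_(c | c != Some i) \int[P 0 i]_(o in exits X c) h o)%E.
Proof.
move=> h0 mh; rewrite ge0_integral_bigsetU//.
- by rewrite big_filter big_enum_cond; apply: eq_bigl => c; rewrite ?andbT.
- by rewrite filter_uniq// enum_uniq.
- by move=> c c' _ _ [x [ec ec']]; exact: exits_uniq ec ec'.
- exact: measurable_funTS.
Qed.

Let PA : P 0 i A = 1%E.
Proof.
rewrite -[LHS]mul1e -integral_cst// intA// -[RHS]exits_mass.
by apply: eq_bigr => c _; rewrite integral_cst//= mul1e.
Qed.

Lemma ae_exits : {ae P 0 i, forall o, exists2 c, c != Some i & exits X c o}.
Proof.
exists (~` A); split; first exact: measurableC.
  by have := probability_setC (P 0 i) mA; rewrite PA subee.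
move=> o nex Ao; apply: nex; move: Ao; rewrite /A -bigcup_seq => -[c /= + oc].
by rewrite mem_filter => /andP[ci _]; exists c.
Qed.

Lemma exits_partition (g : Om -> \bar R) : (forall o, (0 <= g o)%E) ->
  measurable_fun setT g ->
  (\int[P 0 i]_o g o = \sum_(c | c != Some i) \int[P 0 i]_(o in exits X c) g o)%E.
Proof.
move=> g0 mg.
rewrite -intA//.
rewrite (@ge0_negligible_integral _ _ _ _ setT (~` A))//.
- by rewrite setTD setCK.
- exact: measurableC.
- by have := probability_setC (P 0 i) mA; rewrite PA subee.
Qed.

End exit_laws.

(** * The Markov property at the first switch *)

Lemma probability1_ae d (T : measurableType d) (R : realType) (m : probability T R)
    (A : set T) : measurable A -> m A = 1%E -> {ae m, forall x, A x}.
Proof.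
move=> mA m1; exists (~` A); split; first exact: measurableC.
  by rewrite probability_setC// m1 subee.
by [].
Qed.

(** Fatou for an almost everywhere limit, the integrals being bounded by a convergent sequence; the
    lower limit is measurable as the opposite of an upper limit. *)
Lemma fatou_cvg d (T : measurableType d) (R : realType) (m : {measure set T -> \bar R})
    (f_ : nat -> T -> \bar R) (f : T -> \bar R) (b : nat -> \bar R) (l : \bar R) :
  (forall n, measurable_fun setT (f_ n)) -> (forall n x, (0 <= f_ n x)%E) ->
  measurable_fun setT f -> (forall x, (0 <= f x)%E) ->
  {ae m, forall x, f_ ^~ x @ \oo --> f x} ->
  (forall n, (\int[m]_x f_ n x <= b n)%E) -> b @ \oo --> l ->
  (\int[m]_x f x <= l)%E.
Proof.
move=> mf_ f_0 mf f0 f_f f_b bl.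
have inf0 x : (0 <= limn_einf (f_ ^~ x))%E.
  rewrite limn_einf_lim; apply: lime_ge; first exact: is_cvg_einfs.
  by apply: nearW => n; apply: le_ereal_inf_tmp => _ [k _ <-].
have minf : measurable_fun setT (fun x => limn_einf (f_ ^~ x)).
  under eq_fun do rewrite -[limn_einf _]oppeK -limn_esupN.
  apply: measurableT_comp => //; apply: measurable_fun_limn_esup => n.
  exact: measurableT_comp.
rewrite (@ge0_ae_eq_integral _ _ _ m setT f (fun x => limn_einf (f_ ^~ x)))//; last first.
  by apply: filterS f_f => x fx _; have [->] := cvg_limn_einf_sup fx.
apply: le_trans (fatou m measurableT mf_ _) _ => //.
rewrite limn_einf_lim -(cvg_lim _ bl)//.
apply: lee_lim; [exact: is_cvg_einfs|by apply/cvg_ex; exists l|].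
apply: nearW => n; apply: le_trans (f_b n).
by apply: ereal_inf_lbound; exists n => /=.
Qed.

(** * First exit observed on a grid *)

Section grid.
Context (R : realType) (K : nat) (d : measure_display) (Om : measurableType d).
Variables (X : Om -> traj R K) (P : R -> 'I_K -> probability Om R).
Hypothesis X_MAP : nondecreasing_MAP X P.
Variables (i j : 'I_K).
Hypothesis ji : j != i.

Let t n k : R := k%:R / n.+1%:R.

Let t0 n k : 0 <= t n k. Proof. by rewrite divr_ge0. Qed.

(** The starting point is part of the event: [P 0 i] fixes it only almost surely, while facts such
    as [grid_pos_ge0] are used pointwise. *)
Definition grid_event n k : set Om :=
  [set o | grid_exit i n k (Some j) (X o) /\ X o 0 = Some (0, i)].

Definition grid_pos n k o : measurableTypeR R := fine (pos (X o) (t n k)).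

Lemma measurable_start (I : set R) : I 0 ->
  measurable ([set w | w 0 = Some (0, i)] : set (path_space K I)).
Proof.
move=> I0; apply: sub_sigma_algebra; exists 0, i, [set 0]; split=> //.
by apply/seteqP; split=> w /=; [exists 0|move=> [x -> ->]].
Qed.

(** A first exit at grid index k only looks at times up to [t n k], and so may serve as a past event
    in [MAP_markov]. *)
Lemma grid_cylinder n k : cylinder_events `[0, t n k]%classic
  (grid_exit i n k (Some j) `&` [set w | w 0 = Some (0, i)]).
Proof.
pose I : set R := `[0, t n k]%classic.
suff : measurable ((grid_exit i n k (Some j) `&` [set w | w 0 = Some (0, i)]) : set (path_space K I)) by [].
have It l : (l <= k)%N -> I (t n l).
  by move=> lk; rewrite /I /= in_itv/= t0 /t ler_pM2r ?invr_gt0 ?ltr0n// ler_nat.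
apply: measurableI; last by apply: measurable_start; rewrite /I /= in_itv/= lexx t0.
rewrite (_ : grid_exit i n k (Some j) =
   (\bigcap_l (if (l < k)%N then [set w | chain w (t n l) = Some i] else setT)) `&`
   [set w | chain w (t n k) = Some j]); last first.
  apply/seteqP; split=> w [wi wj]; split=> //.
    by move=> l _ /=; case: ifPn => // /wi.
  by move=> l lk; have := wi l; rewrite /= lk; apply.
apply: measurableI; last by apply: measurable_chain; exact: It.
apply: bigcapT_measurable => l; case: ifPn => // /ltnW lk.
by apply: measurable_chain; exact: It.
Qed.

Lemma cylinder_eventsS (I J : set R) (G : set (traj R K)) : I `<=` J ->
  cylinder_events I G -> cylinder_events J G.
Proof.
move=> IJ; apply: sub_sigma_algebra2 => E [s [k [A [Is mA ->]]]].
by exists s, k, A; split=> //; exact: IJ.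
Qed.

Lemma measurable_grid_event n k : measurable (grid_event n k).
Proof.
apply: (@measurable_cylinder _ _ _ _ _ _ X_MAP (grid_exit i n k (Some j) `&` [set w | w 0 = Some (0, i)])).
refine (@cylinder_eventsS `[0, t n k]%classic `[0, +oo[%classic _ _ (@grid_cylinder n k)) => s.
by rewrite /= !in_itv/= andbT => /andP[].
Qed.

Lemma measurable_grid_pos n k : measurable_fun setT (grid_pos n k).
Proof.
apply: (@measurableT_comp _ _ _ _ _ _ fine); first exact: fine_measurable.
exact: (measurable_pos_X X_MAP (t0 n k)).
Qed.

Lemma measurable_final_pos_X : measurable_fun setT (fun o => final_pos (X o)).
Proof. by apply: (measurable_comp_X X_MAP); exact: measurable_final_pos. Qed.

Lemma measurable_final_pos_shift_X n k :
  measurable_fun setT (fun o => final_pos (Defs.shift (t n k) (X o))).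
Proof.
apply: (measurable_comp_X X_MAP (f := fun w => final_pos (Defs.shift (t n k) w))).
exact: measurable_final_pos_shift.
Qed.

Lemma grid_event_alive n k o : grid_event n k o -> X o (t n k) = Some (grid_pos n k o, j).
Proof.
move=> [[_ +] _]; rewrite /grid_pos /pos /chain -/(t n k).
by case: (X o (t n k)) => [[x l]|//] [->].
Qed.

Lemma grid_pos_ge0 n k o : grid_event n k o -> 0 <= grid_pos n k o.
Proof.
move=> Eo; have [_ o0] := Eo.
have := path_nondecreasing (MAP_path X_MAP o) (lexx 0) (t0 n k).
by rewrite /pos o0 (grid_event_alive Eo) lee_fin.
Qed.

Lemma final_pos_grid n k o : grid_event n k o ->
  final_pos (X o) = ((grid_pos n k o)%:E + final_pos (Defs.shift (t n k) (X o)))%E.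
Proof. by move=> /grid_event_alive; exact: final_pos_shift (MAP_path X_MAP o) (t0 n k). Qed.

(** The past event is enriched by a condition A on the position at the grid time; this gives
    independence on rectangles, and then for functions. *)
Lemma grid_markov n k (f : measurableTypeR R -> \bar R) (g : \bar R -> \bar R) :
  (forall x, (0 <= f x)%E) -> (forall z, (0 <= g z)%E) ->
  measurable_fun setT f -> measurable_fun setT g ->
  (\int[P 0 i]_(o in grid_event n k)
     (f (grid_pos n k o) * g (final_pos (Defs.shift (t n k) (X o)))) =
  (\int[P 0 i]_(o in grid_event n k) f (grid_pos n k o)) *
  \int[P 0 j]_o g (final_pos (X o)))%E.
Proof.
move=> f0 g0 mf mg.
apply: (@integral_indep _ _ _ _ _ _ _ _ R (P 0 i) (P 0 j) _ (grid_pos n k)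
  (fun o => final_pos (Defs.shift (t n k) (X o))) (fun o => final_pos (X o)) f g) => //.
- exact: measurable_grid_event.
- exact: measurable_grid_pos.
- exact: measurable_final_pos_shift_X.
- exact: measurable_final_pos_X.
move=> A B mA mB.
pose G : set (traj R K) := grid_exit i n k (Some j) `&` [set w | w 0 = Some (0, i)] `&`
  [set w | exists2 x, w (t n k) = Some (x, j) & A x].
have cG : cylinder_events `[0, t n k]%classic G.
  suff : measurable (G : set (path_space K `[0, t n k])) by [].
  apply: measurableI; first exact: grid_cylinder.
  apply: sub_sigma_algebra; exists (t n k), j, A; split=> //.
  by rewrite /= in_itv/= t0 lexx.
have cD : cylinder_events `[0, +oo[%classic [set w : traj R K | B (final_pos w)].
  suff : measurable ([set w | B (final_pos w)] : set (path_space K `[0, +oo[)) by [].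
  by rewrite -[X in measurable X]setTI; exact: (@measurable_final_pos R K measurableT B mB).
have := MAP_markov X_MAP 0 i j (t0 n k) cG cD.
have -> : [set o | [/\ G (X o), chain (X o) (t n k) = Some j &
     [set w | B (final_pos w)] (Defs.shift (t n k) (X o))]] =
   grid_event n k `&` (grid_pos n k @^-1` A `&`
     (fun o => final_pos (Defs.shift (t n k) (X o))) @^-1` B).
  apply/seteqP; split=> o /=.
    move=> [[Eo [x ox Ax]] _ Bo]; split=> //; split=> //.
    by rewrite /grid_pos /pos ox.
  move=> [Eo [Ao Bo]]; split=> //; last by case: Eo => -[].
  by split=> //; exists (grid_pos n k o) => //; exact: grid_event_alive.
have -> // : [set o | G (X o) /\ chain (X o) (t n k) = Some j] =
  grid_event n k `&` grid_pos n k @^-1` A.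
apply/seteqP; split=> o /=.
  by move=> [[Eo [x ox Ax]] _]; split=> //; rewrite /grid_pos /pos ox.
move=> [Eo Ao]; split; last by case: Eo => -[].
by split=> //; exists (grid_pos n k o) => //; exact: grid_event_alive.
Qed.

(** At most one grid event holds for a given n, so the series selects v at the index of the exit;
    being a series, it integrates term by term. *)
Definition grid_sum (v : nat -> Om -> \bar R) n o : \bar R :=
  (\sum_(k <oo) (v k \_ (grid_event n k)) o)%E.

Lemma patch_ge0 (h : Om -> \bar R) (E : set Om) : (forall o, (0 <= h o)%E) ->
  forall o, (0 <= (h \_ E) o)%E.
Proof. by move=> h0 o; rewrite /patch; case: ifP. Qed.

Lemma grid_sumE v n k o : (forall k o, (0 <= v k o)%E) -> grid_event n k o ->
  grid_sum v n o = v k o.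
Proof.
move=> v0 Eo; rewrite /grid_sum (nneseriesD1 (n := k))//; last by move=> l _; exact: patch_ge0.
rewrite eseries0 ?adde0; first by rewrite /patch mem_set.
move=> l _ /= lk; rewrite /patch memNset// => El.
have ji' : Some j <> Some i by move=> [ij]; move: ji; rewrite ij eqxx.
by have [kl _] := grid_exit_inj ji' ji' Eo.1 El.1; rewrite kl eqxx in lk.
Qed.

Lemma grid_sum0 v n o : (forall k, ~ grid_event n k o) -> grid_sum v n o = 0%E.
Proof.
by move=> nE; rewrite /grid_sum eseries0// => k _ _; rewrite /patch memNset.
Qed.

Lemma grid_sum_ge0 v n o : (forall k o, (0 <= v k o)%E) -> (0 <= grid_sum v n o)%E.
Proof. by move=> v0; apply: nneseries_ge0 => k _ _; exact: patch_ge0. Qed.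

Lemma measurable_grid_sum v n : (forall k o, (0 <= v k o)%E) ->
  (forall k, measurable_fun setT (v k)) -> measurable_fun setT (grid_sum v n).
Proof.
move=> v0 mv; apply: ge0_emeasurable_sum => [k o _ _|k _]; first exact: patch_ge0.
apply/(measurable_restrictT (v k) (@measurable_grid_event n k)).
exact: measurable_funTS.
Qed.

Lemma integral_grid_sum i' v n : (forall k o, (0 <= v k o)%E) ->
  (forall k, measurable_fun setT (v k)) ->
  (\int[P 0 i']_o grid_sum v n o = \sum_(k <oo) \int[P 0 i']_(o in grid_event n k) v k o)%E.
Proof.
move=> v0 mv; rewrite integral_nneseries//.
- by apply: eq_eseriesr => k _; rewrite -integral_mkcond.
- move=> k; apply/(measurable_restrictT (v k) (@measurable_grid_event n k)).
  exact: measurable_funTS.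
- by move=> k o _; exact: patch_ge0.
Qed.


(** For large n the exit seen on the grid has the type c of the true switch: the sum vanishes if c
    is not j, and otherwise its only term is taken at a time of [s, s + e[. *)
Lemma cvg_grid_sum (F : nat -> nat -> Om -> \bar R) (l : \bar R) o c s :
  (forall n k o, (0 <= F n k o)%E) ->
  X o 0 = Some (0, i) -> c <> Some i -> switch_time (X o) = s%:E -> chain (X o) s = c ->
  (c <> Some j -> l = 0%E) ->
  (c = Some j -> forall U, nbhs l U -> exists2 e, 0 < e & forall n k, grid_event n k o ->
     s <= t n k -> t n k < s + e -> U (F n k o)) ->
  grid_sum (F n) n o @[n --> \oo] --> l.
Proof.
move=> F0 o0 ci os oc l0 lF U lU.
have o0c : chain (X o) 0 = Some i by rewrite /chain o0.
have ji' : Some j <> Some i by move=> [ij]; move: ji; rewrite ij eqxx.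
have [cj|cj] := pselect (c = Some j).
  have [e e0 eU] := lF cj U lU.
  apply: filterS (grid_exit_switch (MAP_path X_MAP o) os o0c e0) => n [k [ok /andP[sk ke]]].
  have Eo : grid_event n k o by split=> //; rewrite -cj -oc.
  by rewrite /= (grid_sumE (F0 n) Eo); exact: eU.
have e0 : 0 < 1 :> R by [].
apply: filterS (grid_exit_switch (MAP_path X_MAP o) os o0c e0) => n [k [ok _]].
rewrite /= grid_sum0 -?l0//; first exact: nbhs_singleton.
move=> k' [Eo _]; rewrite oc in ok.
by have [_ ejc] := grid_exit_inj ji' ci Eo ok; apply: cj.
Qed.

Hypothesis ae_exits : {ae P 0 i, forall o, exists2 c, c != Some i & exits X c o}.

Lemma ae_start : {ae P 0 i, forall o, X o 0 = Some (0, i)}.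
Proof.
apply: probability1_ae; last exact: (MAP_start X_MAP).
apply: (@measurable_cylinder _ _ _ _ _ _ X_MAP [set w | w 0 = Some (0, i)]).
by apply: measurable_start; rewrite /= in_itv/= lexx.
Qed.

Lemma ae_cvg_grid_pos (f : R -> R) : continuous f -> (forall x, 0 <= f x) ->
  {ae P 0 i, forall o, grid_sum (fun k o => (f (grid_pos n k o))%:E) n o @[n --> \oo] -->
    ((fun o => (f (pre_pos X o + jump_size X o))%:E) \_ (exits X (Some j))) o}.
Proof.
move=> cf f0; apply: filterS2 ae_start ae_exits => o o0 [c /eqP ci oc].
have [[s os sc] _] := oc.
apply: (cvg_grid_sum (F := fun n k o => (f (grid_pos n k o))%:E) _ o0 ci os sc).
- by move=> n k o'; rewrite lee_fin.
- by move=> cj; rewrite patchE memNset// => /exits_uniq /(_ oc) /esym.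
move=> cj U; rewrite cj in oc sc; rewrite patchE mem_set//.
have rX := MAP_path X_MAP o.
have s0 : 0 <= s by rewrite ltW// -lte_fin -os switch_gt0.
move: sc; rewrite /chain; case oy : (X o s) => [[y k]|//] /= [kj]; rewrite kj in oy.
rewrite -(exits_pos X_MAP oc os oy) => Ul.
have cpos : (f (fine (pos (X o) u)))%:E @[u --> s^'+] --> (f y)%:E.
  have pos_y : pos (X o) u @[u --> s^'+] --> y%:E.
    by have := path_pos_rcont rX s0; rewrite {2}/pos oy.
  have fine_y : fine (pos (X o) u) @[u --> s^'+] --> y by exact: fine_cvg pos_y.
  apply: cvg_EFin; first by near=> u.
  exact: (cvg_comp _ _ fine_y (cf y)).
have [e e0 eU] := at_rightE (cpos _ Ul).
(* A grid point may coincide with s, which a right neighbourhood of s does not cover. *)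
exists e => // n l El; rewrite le_eqVlt => /predU1P[ts|ts] te; last exact: eU.
by rewrite /grid_pos -ts /pos oy /=; exact: nbhs_singleton Ul.
Unshelve. all: by end_near. Qed.

Lemma ae_cvg_grid_final (h : Om -> \bar R) : (forall o, (0 <= h o)%E) ->
  {ae P 0 i, forall o, grid_sum (fun=> h) n o @[n --> \oo] --> (h \_ (exits X (Some j))) o}.
Proof.
move=> h0; apply: filterS2 ae_start ae_exits => o o0 [c /eqP ci oc].
have [[s os sc] _] := oc.
apply: (cvg_grid_sum (F := fun n k => h) _ o0 ci os sc) => //.
  by move=> cj; rewrite patchE memNset// => /exits_uniq /(_ oc) /esym.
move=> cj U; rewrite cj in oc; rewrite patchE mem_set// => /nbhs_singleton Uh.
by exists 1.
Qed.

Section strong_markov.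
Variables (f : R -> R) (g : \bar R -> \bar R).
Hypotheses (cf : continuous f) (f0 : forall x, 0 <= f x).
Hypotheses (mg : measurable_fun setT g) (g0 : forall z, (0 <= g z)%E).
Hypothesis gfin : (\int[P 0 j]_o g (final_pos (X o)) \is a fin_num)%E.

Let Y n := grid_sum (fun k o => (f (grid_pos n k o))%:E) n.
Let Z n := grid_sum (fun _ o => g (final_pos (X o))) n.
Let Yl := (fun o => (f (pre_pos X o + jump_size X o))%:E) \_ (exits X (Some j)).
Let Zl := (fun o => g (final_pos (X o))) \_ (exits X (Some j)).

Let mf : measurable_fun setT (f : measurableTypeR R -> R).
Proof. exact: continuous_measurable_fun. Qed.

Let mpos n k : measurable_fun setT (fun o => (f (grid_pos n k o))%:E).
Proof. by apply/measurable_EFinP; apply: (measurableT_comp mf); exact: measurable_grid_pos. Qed.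

Let mfinal : measurable_fun setT (fun o => g (final_pos (X o))).
Proof. by apply: (measurableT_comp mg); exact: measurable_final_pos_X. Qed.

Let mshift n k : measurable_fun setT (fun o => g (final_pos (Defs.shift (t n k) (X o)))).
Proof. by apply: (measurableT_comp mg); exact: measurable_final_pos_shift_X. Qed.

Let mY n : measurable_fun setT (Y n).
Proof. by apply: measurable_grid_sum => // k o; rewrite lee_fin. Qed.

Let mZ n : measurable_fun setT (Z n).
Proof. by apply: measurable_grid_sum. Qed.

Let mYl : measurable_fun setT Yl.
Proof.
apply/(measurable_restrictT _ (measurable_exits X_MAP (Some j))).
apply: measurable_funTS; apply/measurable_EFinP; apply: (measurableT_comp mf).
by apply: measurable_funD; [exact: (measurable_pre_pos X_MAP)|exact: (measurable_jump_size X_MAP)].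
Qed.

Let mZl : measurable_fun setT Zl.
Proof.
apply/(measurable_restrictT _ (measurable_exits X_MAP (Some j))).
exact: measurable_funTS.
Qed.

(** The restarted process has the same law for all k, so the Markov factor comes out of the
    series. *)
Let intY n : (\int[P 0 i]_o Y n o * \int[P 0 j]_o g (final_pos (X o)) =
  \sum_(k <oo) \int[P 0 i]_(o in grid_event n k)
    ((f (grid_pos n k o))%:E * g (final_pos (Defs.shift (t n k) (X o)))))%E.
Proof.
rewrite integral_grid_sum => [|k o|//]; last by rewrite lee_fin.
rewrite -(fineK gfin) muleC -nneseriesZl; last first.
  by move=> k _; apply: integral_ge0 => o _; rewrite lee_fin.
apply: eq_eseriesr => k _; rewrite muleC fineK//.
have fE0 x : (0 <= (f x)%:E)%E by rewrite lee_fin.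
by rewrite (@grid_markov n k (fun x => (f x)%:E) g)//; exact/measurable_EFinP.
Qed.

(** On each grid event g(xi_{T-}) splits as a bound f times g of the shifted path. Fatou handles
    [Z n], and the bound N gives dominated convergence of [Y n]. *)
Lemma strong_markov_le (N : R) : (forall x, f x <= N) ->
  (forall x z, 0 <= x -> (0 <= z)%E -> (g (x%:E + z) <= (f x)%:E * g z)%E) ->
  (\int[P 0 i]_(o in exits X (Some j)) g (final_pos (X o)) <=
  (\int[P 0 i]_(o in exits X (Some j)) (f (pre_pos X o + jump_size X o))%:E) *
   \int[P 0 j]_o g (final_pos (X o)))%E.
Proof.
move=> fN gsub.
have N0 : 0 <= N by rewrite (le_trans (f0 0)).
rewrite integral_mkcond [X in (_ <= X * _)%E]integral_mkcond -/Yl -/Zl.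
apply: (@fatou_cvg _ _ _ _ Z Zl (fun n => \int[P 0 i]_o Y n o * \int[P 0 j]_o g (final_pos (X o)))%E) => //.
- by move=> n o; exact: grid_sum_ge0.
- exact: patch_ge0.
- exact: ae_cvg_grid_final.
- move=> n; rewrite intY integral_grid_sum//.
  apply: lee_nneseries => [k _ _|k _]; first by apply: integral_ge0.
  apply: ge0_le_integral => //.
  + exact: measurable_grid_event.
  + exact: measurable_funTS.
  + by apply: measurable_funTS; apply: emeasurable_funM.
  + move=> o Eo; rewrite (final_pos_grid Eo); apply: gsub; first exact: grid_pos_ge0 Eo.
    exact: final_pos_shift_ge0 (grid_event_alive Eo).
- apply: cvgeZr => //.
  have [] := @dominated_convergence _ _ _ (P 0 i) setT measurableT Y Yl (cst N%:E) mY mYl.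
  + by apply: filterS (ae_cvg_grid_pos cf f0) => o oY _.
  + exact: finite_measure_integrable_cst.
  + apply: aeW => o n _; rewrite gee0_abs; last by apply: grid_sum_ge0 => k o'; rewrite lee_fin.
    have [[k Ek]|nE] := pselect (exists k, grid_event n k o).
      by rewrite /Y (grid_sumE _ Ek) ?lee_fin// => k' o'; rewrite lee_fin.
    by rewrite /Y grid_sum0 ?lee_fin// => k Ek; apply: nE; exists k.
  by [].
Qed.

(** Here f may be unbounded: Fatou handles [Y n], and [Z n] is dominated by g(xi_{T-}), integrable
    under [P 0 i]. *)
Lemma strong_markov_ge : (\int[P 0 i]_o g (final_pos (X o)) < +oo)%E ->
  (forall x z, 0 <= x -> (0 <= z)%E -> (g (x%:E + z) = (f x)%:E * g z)%E) ->
  ((\int[P 0 i]_(o in exits X (Some j)) (f (pre_pos X o + jump_size X o))%:E) *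
   \int[P 0 j]_o g (final_pos (X o)) <=
  \int[P 0 i]_(o in exits X (Some j)) g (final_pos (X o)))%E.
Proof.
move=> gi gM.
have Y0 n o : (0 <= Y n o)%E by apply: grid_sum_ge0 => k o'; rewrite lee_fin.
have Yl0 o : (0 <= Yl o)%E by apply: patch_ge0 => o'; rewrite lee_fin.
rewrite [leRHS]integral_mkcond [X in (X * _ <= _)%E]integral_mkcond -/Yl -/Zl.
have M0 : (0 <= \int[P 0 j]_o g (final_pos (X o)))%E by exact: integral_ge0.
rewrite -ge0_integralZr//.
apply: (@fatou_cvg _ _ _ _ (fun n o => Y n o * \int[P 0 j]_o g (final_pos (X o)))%E _
   (fun n => \int[P 0 i]_o Z n o)%E) => //.
- by move=> n; apply: emeasurable_funM.
- by move=> n o; exact: mule_ge0.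
- by apply: emeasurable_funM.
- by move=> o; exact: mule_ge0.
- by apply: filterS (ae_cvg_grid_pos cf f0) => o oY; exact: cvgeZr.
- move=> n; rewrite ge0_integralZr// intY integral_grid_sum//.
  apply: lee_nneseries => [k _ _|k _].
    by apply: integral_ge0 => o _; rewrite mule_ge0// lee_fin.
  rewrite le_eqVlt; apply/orP; left; apply/eqP; apply: eq_integral => o /[!inE] Eo.
  rewrite (final_pos_grid Eo) gM//; first exact: grid_pos_ge0 Eo.
  exact: final_pos_shift_ge0 (grid_event_alive Eo).
- have [] := @dominated_convergence _ _ _ (P 0 i) setT measurableT Z Zl
      (fun o => g (final_pos (X o))) mZ mZl.
  + by apply: filterS (ae_cvg_grid_final (fun o => g0 (final_pos (X o)))) => o oY _.
  + apply/integrableP; split=> //.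
    by under eq_integral do rewrite gee0_abs//.
  + apply: aeW => o n _; rewrite gee0_abs; last exact: grid_sum_ge0.
    have [[k Ek]|nE] := pselect (exists k, grid_event n k o).
      by rewrite /Z (grid_sumE _ Ek).
    by rewrite /Z grid_sum0// => k Ek; apply: nE; exists k.
  by [].
Qed.

End strong_markov.

End grid.

(** * The linear system *)

Section exponential_functionals.
Variables (R : realType) (p : R).

Definition exp_neg (z : \bar R) : \bar R := expeR (- (p%:E * z)).

Lemma exp_neg_ge0 z : (0 <= exp_neg z)%E. Proof. exact: expeR_ge0. Qed.

Lemma exp_negE x : exp_neg x%:E = (expR (- (p * x)))%:E. Proof. by []. Qed.

(** At z = +oo the three signs of p differ; for p = 0 the convention 0 times +oo = 0 gives the value
    1. *)
Lemma exp_negD x z : (0 <= z)%E ->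
  exp_neg (x%:E + z) = ((expR (- (p * x)))%:E * exp_neg z)%E.
Proof.
case: z => [y _| _|//]; first by rewrite -EFinD !exp_negE -EFinM -expRD mulrDr opprD.
rewrite addey// /exp_neg; have [p0|p0|->] := ltgtP p 0.
- by rewrite lt0_muley ?lte_fin//= gt0_muley// lte_fin expR_gt0.
- by rewrite gt0_muley ?lte_fin//= mule0.
- by rewrite mul0r !mul0e oppr0 oppe0 expR0 mul1e.
Qed.

Lemma measurable_exp_neg : measurable_fun setT exp_neg.
Proof.
have -> : exp_neg = fun z => if z \is a fin_num then (expR (- (p * fine z)))%:E
    else if z == +oo%E then exp_neg +oo%E else exp_neg -oo%E.
  by apply/funext; case.
apply: measurable_fun_ifT.
- by apply: (measurable_fun_bool true); exact: emeasurable_fin_num.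
- apply/measurable_EFinP; apply: measurableT_comp => //; apply: measurable_funN.
  by apply: measurable_funM => //; exact: fine_measurable.
- apply: measurable_fun_ifT => //; apply: (measurable_fun_bool true); rewrite setTI.
  rewrite (_ : _ @^-1` _ = [set +oo%E]); first exact: emeasurable_set1.
  by apply/seteqP; split=> z /= /eqP.
Qed.

Definition exp_neg_trunc (N : R) (z : \bar R) : \bar R := Order.min (exp_neg z) N%:E.

Lemma exp_neg_trunc_ge0 N z : 0 <= N -> (0 <= exp_neg_trunc N z)%E.
Proof. by move=> N0; rewrite le_min exp_neg_ge0 lee_fin. Qed.

Lemma measurable_exp_neg_trunc N : measurable_fun setT (exp_neg_trunc N).
Proof. by apply: measurable_mine => //; exact: measurable_exp_neg. Qed.

(** min(ab, N) <= min(a, N) min(b, N) holds for N >= 1 when a and b lie on the same side of 1. As x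
    and z are nonnegative, both are at least 1 for p <= 0 and at most 1 for p >= 0. *)
Lemma exp_neg_truncM N x z : 1 <= N -> 0 <= x -> (0 <= z)%E ->
  (exp_neg_trunc N (x%:E + z) <= (Num.min (expR (- (p * x))) N)%:E * exp_neg_trunc N z)%E.
Proof.
move=> N1 x0 z0; have N0 : 0 <= N by lra.
have a0 : 0 < expR (- (p * x)) := expR_gt0 _.
have a1 : p <= 0 -> 1 <= expR (- (p * x)).
  by move=> p0; rewrite -expR0 ler_expR oppr_ge0 mulr_le0_ge0.
have a2 : 0 <= p -> expR (- (p * x)) <= 1.
  by move=> p0; rewrite -expR0 ler_expR oppr_le0 mulr_ge0.
have b1 : p <= 0 -> (1 <= exp_neg z)%E.
  move=> p0; rewrite -expeR0 lee_expeR leeNr oppe0.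
  by rewrite mule_le0_ge0// lee_fin.
have b2 : 0 <= p -> (exp_neg z <= 1)%E.
  move=> p0; rewrite -expeR0 lee_expeR leeNl oppe0.
  by rewrite mule_ge0// lee_fin.
rewrite /exp_neg_trunc exp_negD//; move: b1 b2 (exp_neg_ge0 z).
set a := expR _ in a0 a1 a2 *; case: (exp_neg z) => [b|_ b2 _|//].
- rewrite !lee_fin => b1 b2 b0; rewrite -!EFinM -!EFin_min -EFinM lee_fin.
  rewrite /Num.min; case: ifP => h1; case: ifP => h2; case: ifP => h3;
    move: h1 h2 h3 => /idP h1 /idP h2 /idP h3; rewrite -?leNgt in h1 h2 h3;
    have [p0|p0] := leP p 0; (try have ? := a1 p0); (try have ? := b1 p0);
    (try have ? := a2 (ltW p0)); (try have ? := b2 (ltW p0)); nra.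
- have p0 : p < 0 by rewrite ltNge; apply/negP => /b2; rewrite leye_eq.
  rewrite gt0_muley ?lte_fin// [Order.min +oo%E _]minC !(min_idPl (leey _)) -EFinM lee_fin.
  have := a1 (ltW p0); rewrite /Num.min; case: ifP => _; nra.
Qed.

Lemma cvg_exp_neg_trunc z : exp_neg_trunc n.+1%:R z @[n --> \oo] --> exp_neg z.
Proof.
rewrite /exp_neg_trunc; move: (exp_neg_ge0 z); case: (exp_neg z) => [b _|_|//].
- apply: cvg_near_cst; exists (Num.truncn b) => // n /= bn.
  rewrite -EFin_min min_l// (le_trans (ltW (truncnS_gt _)))// ler_nat ltnS//.
- apply/cvgeyPge => A; exists (Num.truncn A) => // n /= An.
  rewrite minC (min_idPl (leey _)) lee_fin (le_trans (ltW (truncnS_gt _)))// ler_nat ltnS//.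
Qed.

End exponential_functionals.

Section conclusion.
Context (R : realType) (K : nat) (d : measure_display) (Om : measurableType d).
Variables (X : Om -> traj R K) (P : R -> 'I_K -> probability Om R)
  (ch : characteristics R K).
Hypotheses (X_MAP : nondecreasing_MAP X P) (X_ch : has_characteristics X P ch).
Variable p : R.
Hypothesis p_gt : (p_lower ch < p%:E)%E.

Local Notation Phi := (Bernstein_matrix ch p).

(** Unless i is itself the killed type j, the path of positive rates from i to j has a first edge,
    which leaves i because the diagonal rate is nonpositive. *)
Lemma total_rate_gt0 i : irreducible_rates ch -> (exists j, 0 < kill ch j) ->
  0 < kill ch i - rate ch i i.
Proof.
move=> irr [j kj].
have off : rate ch i i = - \sum_(l | l != i) rate ch i l.
  by have := rate_sum0 ch i; rewrite (bigD1 i)//= => /eqP; rewrite addr_eq0 => /eqP.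
have sum0 : 0 <= \sum_(l | l != i) rate ch i l.
  by apply: sumr_ge0 => l li; rewrite rate_ge0// eq_sym.
rewrite off opprK; have [ij|ij] := eqVneq i j.
  by rewrite ltr_pwDl// ij.
rewrite ltr_wpDl ?kill_ge0//.
have /connectP[[|l s] /=] := irr i j; first by move=> _ /esym/eqP; rewrite (negbTE ij).
move=> /andP[il _] _; have li : l != i.
  by apply: contraTneq il => ->; rewrite off oppr_gt0 -leNgt.
rewrite (bigD1 l)//= ltr_pwDl// sumr_ge0// => k /andP[ki _].
by rewrite rate_ge0// eq_sym.
Qed.

Lemma BernsteinE i j : Phi i j =
  if i == j then laplace_exponent ch i p - rate ch i i else - (rate ch i j * jump_laplace ch i j p).
Proof.
rewrite !mxE; case: eqVneq => [<-|_]; last by rewrite mulr0n add0r.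
by rewrite mulr1n /jump_laplace /Rintegral integral_jump_diag mulr1.
Qed.

Lemma Bernstein_off i j : i != j -> Phi i j <= 0.
Proof.
move=> ij; rewrite BernsteinE (negbTE ij) oppr_le0 mulr_ge0 ?rate_ge0//.
by apply: Rintegral_ge0 => x _; exact: expR_ge0.
Qed.

Lemma Bernstein_col i (x : 'cV[R]_K) : (Phi *m x) i 0 =
  (laplace_exponent ch i p - rate ch i i) * x i 0 -
  \sum_(j | j != i) rate ch i j * jump_laplace ch i j p * x j 0.
Proof.
rewrite mxE (bigD1 i)//= BernsteinE eqxx -sumrN; congr (_ + _).
by apply: eq_bigr => j ji; rewrite BernsteinE eq_sym (negbTE ji) mulNr.
Qed.

Hypothesis total_rate : forall i, 0 < kill ch i - rate ch i i.
Variable v : 'cV[R]_K.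
Hypotheses (v0 : forall i, 0 < v i 0) (Phiv : forall i, 0 < (Phi *m v) i 0).

(** Row i of Phi v > 0 bounds r_i v_i below strictly by a nonnegative sum. *)
Lemma diag_gt0 i : 0 < laplace_exponent ch i p - rate ch i i.
Proof.
have := Phiv i; rewrite Bernstein_col subr_gt0 => h.
rewrite -(pmulr_lgt0 _ (v0 i)) (le_lt_trans _ h)//.
apply: sumr_ge0 => j ji; rewrite !mulr_ge0 ?rate_ge0 1?eq_sym//; last exact: ltW.
by apply: Rintegral_ge0 => x _; exact: expR_ge0.
Qed.

Let r i := laplace_exponent ch i p - rate ch i i.
Let a i j := rate ch i j * jump_laplace ch i j p / r i.

Lemma exits_final_None i (g : \bar R -> \bar R) : 
  (\int[P 0 i]_(o in exits X None) g (final_pos (X o)) =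
   \int[P 0 i]_(o in exits X None) g (pre_pos X o)%:E)%E.
Proof.
apply: eq_integral => o /[!inE] eo; have [[s os oN] _] := eo; congr g.
by rewrite (final_pos_killed (MAP_path X_MAP o) os) ?(exits_pre_pos X_MAP eo os)//; exact/chain_None.
Qed.

Lemma exit_laplace_None i :
  (\int[P 0 i]_(o in exits X None) exp_neg p (final_pos (X o)) = (kill ch i / r i)%:E)%E.
Proof.
rewrite exits_final_None; have [mu Hmu] := X_ch i.
apply: (exits_None_laplace X_MAP Hmu _ (diag_gt0 i)) => t t0.
exact: subordinator_laplace (MAP_subordinator Hmu) p_gt t0.
Qed.

Lemma exit_laplace_Some i j : j != i ->
  (\int[P 0 i]_(o in exits X (Some j)) (expR (- (p * (pre_pos X o + jump_size X o))))%:E =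
   (a i j)%:E)%E.
Proof.
move=> ji; have [mu Hmu] := X_ch i.
rewrite (exits_Some_laplace X_MAP Hmu _ (diag_gt0 i) ji) => [|t t0]; last first.
  exact: subordinator_laplace (MAP_subordinator Hmu) p_gt t0.
(* With a zero rate the jump integral may be infinite; both sides are then 0. *)
have [rij|rij] := eqVneq (rate ch i j) 0; first by rewrite /a rij !mul0r mul0e.
have fin := (p_lower_lt p_gt).2 i j rij.
rewrite /a /jump_laplace /Rintegral mulrAC [in RHS]EFinM fineK// ge0_fin_numE//.
by apply: integral_ge0 => x _; rewrite lee_fin expR_ge0.
Qed.

Let F i := (\int[P 0 i]_o exp_neg p (final_pos (X o)))%E.
Let FN n i := (\int[P 0 i]_o exp_neg_trunc p n.+1%:R (final_pos (X o)))%E.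

Let N1 n : 1 <= n.+1%:R :> R. Proof. by rewrite ler1n. Qed.
Let N0 n : 0 <= n.+1%:R :> R. Proof. by rewrite ler0n. Qed.

Let m_final (g : \bar R -> \bar R) : measurable_fun setT g ->
  measurable_fun setT (fun o => g (final_pos (X o))).
Proof.
by move=> mg; apply: (measurableT_comp mg); apply: (measurable_comp_X X_MAP); exact: measurable_final_pos.
Qed.

Let FN_fin n i : FN n i \is a fin_num.
Proof.
have FN0 : (0 <= FN n i)%E by apply: integral_ge0 => o _; exact: exp_neg_trunc_ge0.
rewrite ge0_fin_numE//; apply: le_lt_trans (ltry n.+1%:R).
have -> : n.+1%:R%:E = (\int[P 0 i]_o (cst n.+1%:R%:E) o)%E.
  by rewrite integral_cst// [X in (_ * X)%E](probability_setT (P 0 i)) mule1.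
apply: ge0_le_integral => //.
- by move=> o _; exact: exp_neg_trunc_ge0.
- by apply: m_final; exact: measurable_exp_neg_trunc.
- by move=> o _; rewrite ge_min lexx orbT.
Qed.

Let partition i g : (forall z, (0 <= g z)%E) -> measurable_fun setT g ->
  (\int[P 0 i]_o g (final_pos (X o)) =
   \int[P 0 i]_(o in exits X None) g (final_pos (X o)) +
   \sum_(j | j != i) \int[P 0 i]_(o in exits X (Some j)) g (final_pos (X o)))%E.
Proof.
move=> g0 mg; have [mu Hmu] := X_ch i.
rewrite (exits_partition X_MAP Hmu (total_rate i))//; last exact: m_final.
by rewrite big_option.
Qed.

Let ae_exits_i i : {ae P 0 i, forall o, exists2 c, c != Some i & exits X c o}.
Proof. by have [mu Hmu] := X_ch i; have := ae_exits X_MAP Hmu (total_rate i). Qed.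

Let mexits c : measurable (exits X c). Proof. exact: (measurable_exits X_MAP). Qed.

Let cont_exp : continuous (fun x : R => expR (- (p * x))).
Proof.
move=> x; apply: continuous_comp; last exact: continuous_expR.
by apply: continuousN; apply: mulrl_continuous.
Qed.

Lemma trunc_system n i : (FN n i <= (kill ch i / r i)%:E + \sum_(j | j != i) (a i j)%:E * FN n j)%E.
Proof.
rewrite /FN partition; last 2 first.
- by move=> z; exact: exp_neg_trunc_ge0.
- exact: measurable_exp_neg_trunc.
apply: leeD.
  rewrite -exit_laplace_None; apply: ge0_le_integral => //.
  - by move=> o _; exact: exp_neg_trunc_ge0.
  - by apply: measurable_funTS; apply: m_final; exact: measurable_exp_neg_trunc.
  - by apply: measurable_funTS; apply: m_final; exact: measurable_exp_neg.
  - by move=> o _; rewrite ge_min lexx.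
apply: lee_sum => j ji.
apply: (le_trans (@strong_markov_le _ _ _ _ _ _ X_MAP _ _ ji (ae_exits_i i)
  (fun x => Num.min (expR (- (p * x))) n.+1%:R) (exp_neg_trunc p n.+1%:R) _ _ _ _ _ n.+1%:R _ _)).
- apply: (@min_fun_continuous _ _ R (fun x => expR (- (p * x))) (cst n.+1%:R)).
    exact: cont_exp.
  exact: cst_continuous.
- by move=> x; rewrite le_min expR_ge0 N0.
- exact: measurable_exp_neg_trunc.
- by move=> z; exact: exp_neg_trunc_ge0.
- exact: FN_fin.
- by move=> x; rewrite ge_min lexx orbT.
- by move=> x z x0 z0; exact: (exp_neg_truncM p (N1 n) x0 z0).
(* The truncation of f has served dominated convergence; enlarging f to exp(- p x) produces the
   coefficient a_{i,j}. *)
rewrite -exit_laplace_Some//; apply: lee_wpmul2r.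
  by apply: integral_ge0 => o _; exact: exp_neg_trunc_ge0.
have mj : measurable_fun setT (fun o => pre_pos X o + jump_size X o).
  by apply: measurable_funD; [exact: (measurable_pre_pos X_MAP)|exact: (measurable_jump_size X_MAP)].
apply: ge0_le_integral => //.
- apply/measurable_EFinP; apply: measurable_funTS; apply: measurable_minr => //.
  by apply: measurableT_comp => //; apply: measurable_funN; exact: measurable_funM.
- apply/measurable_EFinP; apply: measurable_funTS.
  by apply: measurableT_comp => //; apply: measurable_funN; exact: measurable_funM.
- by move=> o _; rewrite lee_fin ge_min lexx.
Qed.

Variable y : 'cV[R]_K.
Hypothesis Phiy : Phi *m y = \col_i kill ch i.

(** Row k of Phi (y - x) >= 0 is [trunc_system] multiplied by r_k > 0, so monotonicity applies with
    the supersolution v. *)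
Lemma trunc_bound n i : (FN n i <= (y i 0)%:E)%E.
Proof.
pose x : 'cV[R]_K := \col_i fine (FN n i).
suff : 0 <= (y - x) i 0.
  by rewrite !mxE subr_ge0 -lee_fin fineK.
apply: (Zmatrix_mono Bernstein_off v0 Phiv) => k.
rewrite mulmxBr Phiy mxE [X in _ + X]mxE Bernstein_col mxE subr_ge0 lerBlDr.
rewrite [x k 0]mxE.
have h := trunc_system n k; rewrite -(fineK (FN_fin n k)) in h.
rewrite mulrC -ler_pdivlMr ?diag_gt0// -lee_fin (le_trans h)// mulrDl EFinD leeD2l//.
rewrite mulr_suml -sumEFin; apply: lee_sum => j jk.
by rewrite -(fineK (FN_fin n j)) -EFinM lee_fin mxE /a /r mulrAC.
Qed.

Lemma laplace_bound i : (F i <= (y i 0)%:E)%E.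
Proof.
apply: (@fatou_cvg _ _ _ (P 0 i) (fun n o => exp_neg_trunc p n.+1%:R (final_pos (X o))) _
  (fun=> (y i 0)%:E)).
- by move=> n; apply: m_final; exact: measurable_exp_neg_trunc.
- by move=> n o; exact: exp_neg_trunc_ge0.
- by apply: m_final; exact: measurable_exp_neg.
- by move=> o; exact: exp_neg_ge0.
- by apply: aeW => o; exact: cvg_exp_neg_trunc.
- by move=> n; exact: trunc_bound.
- exact: cvg_cst.
Qed.

(** [laplace_bound] makes F finite, hence integrable enough for [strong_markov_ge] with the
    untruncated exponential; this gives Phi (F - y) >= 0. *)
Lemma laplace_eq i : F i = (y i 0)%:E.
Proof.
have F0 k : (0 <= F k)%E by apply: integral_ge0 => o _; exact: exp_neg_ge0.
have Ffin k : F k \is a fin_num.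
  by rewrite ge0_fin_numE// (le_lt_trans (laplace_bound k))// ltry.
pose x : 'cV[R]_K := \col_i fine (F i).
apply/eqP; rewrite eq_le laplace_bound/=.
suff : 0 <= (x - y) i 0 by rewrite !mxE subr_ge0 -lee_fin fineK.
apply: (Zmatrix_mono Bernstein_off v0 Phiv) => k.
rewrite mulmxBr Phiy mxE Bernstein_col [X in _ + X]mxE [X in _ - X]mxE subr_ge0 lerBrDr.
rewrite [x k 0]mxE.
rewrite mulrC -ler_pdivrMr ?diag_gt0// -lee_fin fineK//.
rewrite /F partition; last 2 first.
- exact: exp_neg_ge0.
- exact: measurable_exp_neg.
rewrite exit_laplace_None mulrDl EFinD leeD2l// mulr_suml -sumEFin; apply: lee_sum => j jk.
rewrite -/(r k) mulrAC -/(a k j) EFinM -exit_laplace_Some// [x j 0]mxE fineK//.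
apply: (@strong_markov_ge _ _ _ _ _ _ X_MAP _ _ jk (ae_exits_i k)
  (fun x => expR (- (p * x))) (exp_neg p)) => //.
- exact: measurable_exp_neg.
- by move=> z; exact: exp_neg_ge0.
- exact: Ffin.
- by have := Ffin k; rewrite ge0_fin_numE.
- by move=> z w _; exact: exp_negD.
Qed.

End conclusion.

Theorem proposition1p5 (R : realType) (K : nat)
  (d : measure_display) (Om : measurableType d)
  (X : Om -> traj R K) (P : R -> 'I_K -> probability Om R)
  (ch : characteristics R K)
  (X_MAP : nondecreasing_MAP X P)
  (X_ch : has_characteristics X P ch)
  (irr : irreducible_rates ch)
  (nonconst : ~ position_as_constant X P)
  (killed : exists i, 0 < kill ch i)
  (p : R) (p_gt : (p_lower ch < p%:E)%E)
  (abscissa_gt0 : 0 < - spectral_abscissa (- Bernstein_matrix ch p)) :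
  Bernstein_matrix ch p \in unitmx /\
  \col_i death_laplace X P i p =
  map_mx EFin (invmx (Bernstein_matrix ch p) *m \col_i kill ch i).
Proof.
have unit_s s : 0 <= s -> s%:M + Bernstein_matrix ch p \in unitmx.
  by move=> s0; apply: spectral_abscissa_lt0_unit => //; rewrite -oppr_gt0.
have uPhi : Bernstein_matrix ch p \in unitmx.
  by have := unit_s 0 (lexx 0); rewrite raddf0 add0r.
have [v [v0 Phiv]] := hurwitz_Zmatrix_supersolution (@Bernstein_off _ _ ch p) unit_s.
have tot i := total_rate_gt0 i irr killed.
split=> //; apply/matrixP => i k; rewrite (ord1 k) [LHS]mxE [RHS]mxE.
have Phiy : Bernstein_matrix ch p *m (invmx (Bernstein_matrix ch p) *m \col_i kill ch i) =
  \col_i kill ch i by rewrite mulKVmx.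
rewrite -[RHS](laplace_eq X_MAP X_ch p_gt tot v0 Phiv Phiy).
by apply: eq_integral => o _; rewrite (pos_before_deathE (MAP_path X_MAP o)).
Qed.
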